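(* Let $V$ be an infinite-dimensional vector space over a field $\mathbb{F}$ of characteristic $2$, and let $u\in\mathrm{End}(V)$. Then $u$ is the sum of three idempotent endomorphisms of $V$ if and only if none of the following conditions holds: (i) $u$ has a dominant eigenvalue outside of $\{0_{\mathbb{F}},1_{\mathbb{F}}\}$; (ii) there exists $\lambda\in\{0_{\mathbb{F}},1_{\mathbb{F}}\}$ such that $u-\lambda\,\mathrm{id}_V$ has finite rank and trace outside of $\{0_{\mathbb{F}},1_{\mathbb{F}}\}$.
   Context: A scalar $\lambda$ is a dominant eigenvalue of $u\in\mathrm{End}(V)$ if $\operatorname{rk}(u-\lambda\,\mathrm{id}_V)<\dim V$. An endomorphism $e$ is idempotent if $e^2=e$. *)

(* Defs.v *)
From HB Require Import structures.
From mathcomp Require Import all_boot all_order all_algebra.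
From mathcomp Require Import boolp classical_sets cardinality.
Set Implicit Arguments. Unset Strict Implicit. Unset Printing Implicit Defensive.
Import Order.TTheory GRing.Theory.
Local Open Scope ring_scope.
Local Open Scope classical_set_scope.
Local Open Scope card_scope.

Section LinDefs.
Variables (F : fieldType) (V : lmodType F).

Definition in_span_seq (s : seq V) (x : V) : Prop :=
  exists c : 'I_(size s) -> F, x = \sum_(i < size s) c i *: s`_i.

Definition span_set (B : set V) : set V :=
  [set x | exists s : seq V, {subset s <= B} /\ in_span_seq s x].

Definition free_set (B : set V) : Prop :=
  forall s : seq V, uniq s -> {subset s <= B} ->
  forall c : 'I_(size s) -> F,
    \sum_(i < size s) c i *: s`_i = 0 -> forall i, c i = 0.

Definition basis_of_set (S B : set V) : Prop :=
  B `<=` S /\ free_set B /\ S `<=` span_set B.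

Definition infinite_dim : Prop :=
  ~ exists s : seq V, forall x, in_span_seq s x.

Definition rank_lt_dim (g : V -> V) : Prop :=
  exists B C : set V, basis_of_set (range g) B /\ basis_of_set setT C /\
    ~ (C #<= B).

Definition dominant_eigenvalue (u : V -> V) (l : F) : Prop :=
  rank_lt_dim (fun x => u x - l *: x).

Definition finite_rank (g : V -> V) : Prop :=
  exists s : seq V, forall x, in_span_seq s (g x).

(* t is the trace of the finite-rank endomorphism g: writing
   g = sum_k phi_k(.) w_k with linear forms phi_k, tr g = sum_k phi_k(w_k)
   (this value is independent of the decomposition) *)
Definition is_trace (g : V -> V) (t : F) : Prop :=
  exists (n : nat) (w : 'I_n -> V) (phi : 'I_n -> {linear V -> F^o}),
    (forall x, g x = \sum_(k < n) phi k x *: w k) /\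
    t = \sum_(k < n) phi k (w k).

Definition idempotent_end (e : {linear V -> V}) : Prop :=
  forall x, e (e x) = e x.

Definition sum_of_three_idempotents (u : {linear V -> V}) : Prop :=
  exists e1 e2 e3 : {linear V -> V},
    [/\ idempotent_end e1, idempotent_end e2, idempotent_end e3 &
        forall x, u x = e1 x + e2 x + e3 x].

End LinDefs.

(* Main.v *)
(** Call an endomorphism a swap when it exchanges the two summands of some
    decomposition of the space. In characteristic 2, if u = e + N with e
    idempotent and N a swap, then u is a sum of three idempotents: 1 + N is the
    sum of the idempotents [[1, *], [0, 0]] and [[0, 0], [*, 1]], and e - 1 is
    idempotent.

    Infinite rank. A maximal set S such that the vectors x, u x (x in S) are
    independent is as large as the rank of u. Let e vanish on S and send any other
    vector b of a basis containing S and u(S) to b - m(b), where m(b) in S is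
    chosen injectively and far beyond the supports of b and u b. Then u - e is
    a shift up to lower terms, hence a swap.

    Finite rank. The space is a direct sum of cyclic blocks and of a part of the
    kernel. Blocks are linked by e into chains, a chain being closed as soon as
    the trace accumulated along it falls in {0, 1}. On a chain, the freedom left in
    e makes u - e cyclic with a characteristic polynomial that is even or odd,
    hence a swap; the partial traces outside {0, 1} provide exactly the nonzero
    pivots needed to kill the coefficients of the wrong parity.

    Necessity. If p + q + r = l + w with p, q, r idempotent, then (l^2 + l) id
    lies in the ideal generated by w. If moreover l = 0 and w has finite rank,
    then p, q and r stabilize a finite-dimensional subspace W containing the range
    of w, and an idempotent matrix P satisfies (tr P)^2 = tr (P^2) = tr P. *)

Require Import Defs.
From HB Require Import structures.
From mathcomp Require Import all_boot all_order all_algebra.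
From mathcomp Require Import boolp classical_sets functions cardinality.
Import GRing.Theory.
Local Open Scope ring_scope.

Set Implicit Arguments.
Unset Strict Implicit.
Unset Printing Implicit Defensive.
Local Open Scope classical_set_scope.

(** * Linear algebra in arbitrary dimension *)

(** In infinite rank, the obstacle is that [S] may be too small when [u] is close to a scalar: for
    [u = id] it is empty. Maximality leaves two possibilities: [S] and [u(S)] span a subspace of
    codimension at most 1, or [u - l id] takes its values in their span for some [l]. In the latter
    case [S] is large enough if [l] is not dominant, or if 0 is dominant and the rank is infinite. A
    dominant eigenvalue 1 is brought back to 0 by passing to [u - id]. In finite rank, the diagonal
    of [u - e] is that of [u] shifted by 1 at the end of each block. These shifts add up to 0 or 1,
    so a partial trace outside {0, 1} stays nonzero, while one in {0, 1} leaves a defect 0 or 1.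
    Infinite dimension supplies kernel vectors outside the range: one absorbs the defect 1, and
    another, added to an eigenvector, produces a block of size at least 2. *)

Lemma total_on_seq (T : Type) (U : eqType) (F : set (set T)) (Q : set T -> U -> Prop)
    (s : seq U) :
  total_on F subset -> F !=set0 ->
  (forall X Y x, X `<=` Y -> Q X x -> Q Y x) ->
  (forall x, x \in s -> exists2 X, F X & Q X x) ->
  exists2 X, F X & forall x, x \in s -> Q X x.
Proof.
move=> Ftot [X0 FX0] Qmono; elim: s => [|x s IHs] sQ; first by exists X0.
have [|Y FY sY] := IHs; first by move=> y ys; apply: sQ; rewrite inE ys orbT.
have [Z FZ xZ] := sQ x (mem_head _ _).
have [YZ|ZY] := Ftot _ _ FY FZ.
  by exists Z => // y /predU1P[-> //|ys]; apply: Qmono YZ (sY _ ys).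
by exists Y => // y /predU1P[-> //|ys]; [apply: Qmono ZY xZ|apply: sY].
Qed.

(** A predicate on bare functions: the maps below arise as sums, iterates and extensions from a
    basis, and bundling is postponed to the end. *)
Definition lin (F : fieldType) (V W : lmodType F) (f : V -> W) : Prop :=
  forall a x y, f (a *: x + y) = a *: f x + f y.

Section Lin.
Variables (F : fieldType) (V W U : lmodType F).

Section LinTheory.
Variables (f : V -> W) (fl : lin f).

Lemma linD x y : f (x + y) = f x + f y.
Proof. by rewrite -[x]scale1r fl !scale1r. Qed.

Lemma lin0 : f 0 = 0.
Proof. by apply: (addrI (f 0)); rewrite -linD !addr0. Qed.

Lemma linZ a x : f (a *: x) = a *: f x.
Proof. by rewrite -[a *: x]addr0 fl lin0 addr0. Qed.

Lemma linN x : f (- x) = - f x.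
Proof. by rewrite -scaleN1r linZ scaleN1r. Qed.

Lemma linB x y : f (x - y) = f x - f y.
Proof. by rewrite linD linN. Qed.

Lemma lin_sum (I : Type) (r : seq I) (P : pred I) (g : I -> V) :
  f (\sum_(i <- r | P i) g i) = \sum_(i <- r | P i) f (g i).
Proof. by apply: (big_morph f linD lin0). Qed.

End LinTheory.

Lemma lin_zero : lin (fun _ : V => 0 : W).
Proof. by move=> a x y; rewrite scaler0 addr0. Qed.

Lemma lin_comp (f : V -> W) (g : U -> V) : lin f -> lin g -> lin (f \o g).
Proof. by move=> fl gl a x y /=; rewrite gl fl. Qed.

Lemma lin_add (f g : V -> W) : lin f -> lin g -> lin (fun x => f x + g x).
Proof. by move=> fl gl a x y; rewrite fl gl scalerDr addrACA. Qed.

Lemma lin_scale b (f : V -> W) : lin f -> lin (fun x => b *: f x).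
Proof. by move=> fl a x y; rewrite fl scalerDr !scalerA mulrC. Qed.

Lemma lin_opp (f : V -> W) : lin f -> lin (fun x => - f x).
Proof. by move=> fl a x y; rewrite fl opprD scalerN. Qed.

Lemma lin_sub (f g : V -> W) : lin f -> lin g -> lin (fun x => f x - g x).
Proof. by move=> fl gl; apply/lin_add/lin_opp. Qed.

Lemma lin_form (c : V -> F^o) (w : W) : lin c -> lin (fun x => c x *: w).
Proof. by move=> cl a x y; rewrite cl scalerDl -scalerA. Qed.

Lemma lin_bigsum (I : Type) (r : seq I) (P : pred I) (f : I -> V -> W) :
  (forall i, P i -> lin (f i)) -> lin (fun x => \sum_(i <- r | P i) f i x).
Proof.
move=> fl a x y; rewrite scaler_sumr -big_split /=.
by apply: eq_bigr => i Pi; rewrite fl.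
Qed.

Lemma lin_linear (f : {linear V -> W}) : lin f.
Proof. by move=> a x y; rewrite linearP. Qed.

Definition pack_lin (f : V -> W) (fl : lin f) : {linear V -> W} :=
  HB.pack f (GRing.isLinear.Build F V W *:%R f fl).

End Lin.

(** * Spans, free sets and extension of free sets *)

Section Span.
Variables (F : fieldType) (V : lmodType F).
Implicit Types (A B C : set V) (x y z : V).

Inductive span A : V -> Prop :=
| span0 : span A 0
| spanP a x y : A x -> span A y -> span A (a *: x + y).

Lemma span_lin A a x y : span A x -> span A y -> span A (a *: x + y).
Proof.
elim=> [|b z w Az _ IHw] Ay; first by rewrite scaler0 add0r.
by rewrite scalerDr scalerA -addrA; apply: spanP (IHw Ay).
Qed.

Lemma span_in A x : A x -> span A x.
Proof. by move=> Ax; rewrite -[x]addr0 -[x in x + _]scale1r; apply/spanP/span0. Qed.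

Lemma spanD A x y : span A x -> span A y -> span A (x + y).
Proof. by move=> Ax; rewrite -[x]scale1r; apply: span_lin. Qed.

Lemma spanZ A a x : span A x -> span A (a *: x).
Proof. by move=> Ax; rewrite -[_ *: x]addr0; apply/span_lin/span0. Qed.

Lemma spanN A x : span A x -> span A (- x).
Proof. by rewrite -scaleN1r; apply: spanZ. Qed.

Lemma spanB A x y : span A x -> span A y -> span A (x - y).
Proof. by move=> Ax /spanN; apply: spanD. Qed.

Lemma span_sum A (I : eqType) (r : seq I) (P : pred I) (f : I -> V) :
  (forall i, i \in r -> P i -> span A (f i)) ->
  span A (\sum_(i <- r | P i) f i).
Proof.
move=> Af; rewrite big_seq_cond; apply: (big_ind (span A)) => //.
- exact: span0.
- exact: spanD.
- by move=> i /andP[]; apply: Af.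
Qed.

Lemma span_trans A B x : (forall y, A y -> span B y) -> span A x -> span B x.
Proof.
by move=> AB; elim=> [|a y z Ay _ Bz]; [apply: span0|apply/span_lin/Bz/AB].
Qed.

Lemma span_sub A B x : A `<=` B -> span A x -> span B x.
Proof. by move=> AB; apply: span_trans => y /AB; apply: span_in. Qed.

Lemma span_fin A x : span A x ->
  exists2 s : seq V, (forall y, y \in s -> A y) & span [set` s] x.
Proof.
elim=> [|a y z Ay _ [s sA sz]]; first by exists [::] => //; apply: span0.
exists (y :: s) => [w|]; first by rewrite inE => /predU1P[->|/sA].
apply: spanP => /=; first by rewrite inE eqxx.
by apply: span_sub sz => w /= ws; rewrite inE ws orbT.
Qed.

Lemma span_exch A x y : span (x |` A) y -> exists a, span A (y - a *: x).
Proof.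
elim=> [|a z w [->|Az] _ [b Ab]].
- by exists 0; rewrite scale0r subr0; apply: span0.
- exists (a + b); rewrite scalerDl opprD addrACA subrr add0r //.
- by exists b; rewrite -addrA; apply: spanP.
Qed.

Definition free A := forall x, A x -> ~ span (A `\ x) x.

Lemma free_sub A B : A `<=` B -> free B -> free A.
Proof.
move=> AB fB x Ax /(span_sub (B := B `\ x)) xB.
by apply: (fB x (AB _ Ax)); apply: xB => y [/AB].
Qed.

Lemma free_set0 : free set0. Proof. by []. Qed.

Lemma free_add A y : free A -> ~ span A y -> free (y |` A).
Proof.
move=> fA nAy z yAz szz.
have [zy|/eqP zy] := eqVneq z y.
  by case: nAy; move: szz; rewrite zy; apply: span_sub => w [[->|]] // [].
have Az : A z by case: yAz.
have /span_exch[a Aa] : span (y |` (A `\ z)) z.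
  by apply: span_sub szz => w [[->|Aw] wz]; [left|right].
have [a0|a_neq0] := eqVneq a 0.
  by apply: (fA z Az); move: Aa; rewrite a0 scale0r subr0.
apply: nAy.
have -> : y = a^-1 *: (z - (z - a *: y)).
  by rewrite opprB addrC subrK scalerA mulVf ?scale1r.
apply/spanZ/spanB; first exact: span_in.
by apply: span_sub Aa => w [].
Qed.

Lemma extend_free A G : free A ->
  exists C, [/\ C `<=` G, free (A `|` C), forall x, C x -> ~ A x &
    forall x, G x -> span (A `|` C) x].
Proof.
move=> fA.
pose P := [set C | [/\ C `<=` G, free (A `|` C) & forall x, C x -> ~ A x]].
have [Ch FP Ftot|C [[CG fC CA] Cmax]] := @Zorn_bigcup V P.
  split; first by move=> x [X /FP[XG _ _] /XG].
    have [F0|/set0P/negP/negbNE/eqP->] := pselect (Ch !=set0); last first.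
      by rewrite bigcup_set0 setU0.
    move=> x xU /span_fin[s sU sx].
    have [|X FX /(_ _ _)XQ] := @total_on_seq V V Ch (fun X y => (A `|` X) y)
        (x :: s) Ftot F0 (fun X Y y XY => (@setUS _ A X Y XY y)).
      move=> y yxs; have : (A `|` \bigcup_(X in Ch) X) y.
        by case/predU1P: yxs => [-> //|/sU[]].
      case=> [Ay|[X FX Xy]]; last by exists X => //; right.
      by have [X FX] := F0; exists X => //; left.
    have [_ fX _] := FP _ FX.
    apply: (fX x); first by apply: XQ; rewrite mem_head.
    apply: span_sub sx => y /= ys; split; last by have [] := sU _ ys.
    by apply: XQ; rewrite inE ys orbT.
  by move=> x [X /FP[_ _ XA] /XA].
exists C; split=> // x Gx; apply: contrapT => nx.
have nACx : ~ (A `|` C) x by move=> /span_in.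
apply: (Cmax (x |` C)).
  split; first by move=> y Cy; right.
  by move=> /(_ x (or_introl erefl)) Cx; apply: nACx; right.
split; first by move=> y [->|/CG].
  by rewrite setUCA; apply: free_add.
by move=> y [->|/CA//]; move=> Ax; apply: nACx; left.
Qed.

End Span.

(** * Coordinates, linear extension and separating forms *)

Section Coord.
Variables (F : fieldType) (V : lmodType F).
Implicit Types (A B C : set V) (x y z : V).

Definition basis B := free B /\ forall x, span B x.

(* Junk value: 0 when no scalar qualifies. *)
Definition coord B x y : F^o := xget 0 [set a : F^o | span (B `\ x) (y - a *: x)].

Section Basis.
Variables (B : set V) (Bb : basis B).

Let coord_uniq x y (a b : F) : B x -> span (B `\ x) (y - a *: x) ->
  span (B `\ x) (y - b *: x) -> a = b.
Proof.
move=> Bx Ba Bb'; apply/eqP; rewrite -subr_eq0; apply/negPn/negP => ab.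
case: Bb => fB _; apply: (fB x Bx).
have eqx : x = (a - b)^-1 *: ((y - b *: x) - (y - a *: x)).
  have -> : y - b *: x - (y - a *: x) = a *: x - b *: x.
    by rewrite [LHS]addrC opprB addrA subrK.
  by rewrite -scalerBl scalerA mulVf ?scale1r.
by rewrite [X in span _ X]eqx; apply/spanZ/spanB.
Qed.

Lemma coordP x y : B x -> span (B `\ x) (y - coord B x y *: x).
Proof.
move=> Bx; have [fB sB] := Bb.
have /span_exch[a Pa] : span (x |` (B `\ x)) y.
  by apply: span_sub (sB y) => z Bz; have [->|/eqP zx] := eqVneq z x; [left|right].
by rewrite /coord; case: xgetP => [b -> //|/(_ a)].
Qed.

Lemma coord_eq x y a : B x -> span (B `\ x) (y - a *: x) -> coord B x y = a.
Proof. by move=> Bx Pa; apply: (coord_uniq Bx (coordP y Bx) Pa). Qed.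

Lemma coord_lin x : B x -> lin (coord B x).
Proof.
move=> Bx a y z; apply: coord_eq => //.
have -> : a *: y + z - (a *: coord B x y + coord B x z) *: x =
    a *: (y - coord B x y *: x) + (z - coord B x z *: x).
  by rewrite scalerDl opprD addrACA scalerBr scalerA.
by apply: span_lin; apply: coordP.
Qed.

Lemma coordx x : B x -> coord B x x = 1.
Proof. by move=> Bx; apply: coord_eq => //; rewrite scale1r subrr; apply: span0. Qed.

Lemma coord0 x y : B x -> span (B `\ x) y -> coord B x y = 0.
Proof. by move=> Bx sy; apply: coord_eq; rewrite // scale0r subr0. Qed.

Lemma coord_neq x y : B x -> B y -> y <> x -> coord B x y = 0.
Proof. by move=> Bx By yx; apply: coord0 => //; apply: span_in. Qed.

(** The expansion is claimed over every larger list of basis vectors, so that several vectors can be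
    expanded over a common list; this makes [ext] additive although [supp y] is an arbitrary
    choice. *)
Let supp_ex y : exists s : seq V, [/\ uniq s, forall x, x \in s -> B x &
  forall s' : seq V, uniq s' -> {subset s <= s'} ->
    (forall x, x \in s' -> B x) -> y = \sum_(x <- s') coord B x y *: x].
Proof.
case: Bb => _ /(_ y); elim=> [|a z w Bz _ [s [us sB sw]]].
  exists [::]; split=> // s' _ _ s'B.
  rewrite big_seq big1 // => x /s'B Bx.
  by rewrite coord0 ?scale0r //; apply: span0.
exists (undup (z :: s)); split; first exact: undup_uniq.
  by move=> x; rewrite mem_undup inE => /predU1P[->|/sB].
move=> s' us' sub s'B.
have zs' : z \in s' by apply: sub; rewrite mem_undup mem_head.
rewrite [X in _ + X = _](sw s') //; last first.
  by move=> x xs; apply: sub; rewrite mem_undup inE xs orbT.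
have ez : z = \sum_(x <- s') coord B x z *: x.
  rewrite (bigD1_seq z) //= big_seq_cond big1 ?coordx ?scale1r ?addr0 //.
  by move=> x /andP[/s'B Bx /eqP xz]; rewrite coord_neq ?scale0r // => /esym.
rewrite [X in a *: X + _ = _]ez scaler_sumr -big_split /= [LHS]big_seq [RHS]big_seq.
by apply: eq_bigr => x /s'B Bx; rewrite coord_lin // scalerDl scalerA.
Qed.

Definition supp y : seq V := projT1 (cid (supp_ex y)).

Let suppP y := projT2 (cid (supp_ex y)).

Lemma supp_sub x y : x \in supp y -> B x.
Proof. by case: (suppP y) => _ h _ /h. Qed.

Lemma coord_nsupp x y : B x -> x \notin supp y -> coord B x y = 0.
Proof.
move=> Bx xs; have [us sB eqy] := suppP y; apply: coord0 => //.
rewrite (eqy _ us) //; apply: span_sum => z zs _; apply/spanZ/span_in.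
by split; [apply: sB|move=> /= zx; rewrite -zx zs in xs].
Qed.

Variables (W : lmodType F) (f : V -> W).

Definition ext y : W := \sum_(x <- supp y) coord B x y *: f x.

Let extE y (s : seq V) : uniq s -> {subset supp y <= s} ->
  (forall x, x \in s -> B x) -> ext y = \sum_(x <- s) coord B x y *: f x.
Proof.
move=> us sub sB; rewrite (bigID (mem (supp y))) /= addrC.
rewrite big_seq_cond big1 ?add0r; last first.
  by move=> x /andP[/sB Bx xs]; rewrite coord_nsupp ?scale0r.
rewrite -big_filter; apply: perm_big; apply: uniq_perm.
- by case: (suppP y).
- exact: filter_uniq.
- by move=> x; rewrite mem_filter; case: (boolP (x \in supp y)) => //= /sub ->.
Qed.

Lemma ext_lin : lin ext.
Proof.
move=> a y z.
pose s := undup (supp (a *: y + z) ++ supp y ++ supp z).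
have us : uniq s := undup_uniq _.
have sB x : x \in s -> B x.
  by rewrite mem_undup !mem_cat => /or3P[] /supp_sub.
have s1 : {subset supp (a *: y + z) <= s}.
  by move=> x xs; rewrite mem_undup !mem_cat xs.
have s2 : {subset supp y <= s} by move=> x xs; rewrite mem_undup !mem_cat xs !orbT.
have s3 : {subset supp z <= s} by move=> x xs; rewrite mem_undup !mem_cat xs !orbT.
rewrite (extE us s1 sB) (extE us s2 sB) (extE us s3 sB) scaler_sumr -big_split /=.
rewrite !big_seq; apply: eq_bigr => x /sB Bx.
by rewrite coord_lin // scalerDl scalerA.
Qed.

Lemma ext_on_basis x : B x -> ext x = f x.
Proof.
move=> Bx; pose s := undup (x :: supp x).
have us : uniq s := undup_uniq _.
have sB y : y \in s -> B y by rewrite mem_undup inE => /predU1P[->|/supp_sub].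
have xs : x \in s by rewrite mem_undup mem_head.
rewrite (extE us _ sB) => [|y ys]; last by rewrite mem_undup inE ys orbT.
rewrite (bigD1_seq x) //= coordx // scale1r big_seq_cond big1 ?addr0 //.
by move=> y /andP[/sB By /eqP yx]; rewrite coord_neq ?scale0r // => /esym.
Qed.

End Basis.

Lemma eq_on_basis (W : lmodType F) (f g : V -> W) B : basis B ->
  lin f -> lin g -> (forall x, B x -> f x = g x) -> forall x, f x = g x.
Proof.
move=> [_ sB] fl gl fg x; have := sB x.
elim=> [|a y z By _ IHz]; first by rewrite !lin0.
by rewrite fl gl fg // IHz.
Qed.

Lemma extend_to_basis A G : free A -> (forall x, span (A `|` G) x) ->
  exists C, [/\ C `<=` G, basis (A `|` C) & forall x, C x -> ~ A x].
Proof.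
move=> fA sAG; have [C [CG fC CA GC]] := extend_free G fA.
exists C; split=> //; split=> // x; apply: span_trans (sAG x) => y.
by case=> [Ay|/GC//]; apply: span_in; left.
Qed.

(** The form is the coordinate along [x] in a basis containing [x] and a maximal free part of
    [A]. *)
Lemma sep_form A x : ~ span A x ->
  exists c : V -> F^o, [/\ lin c, c x = 1 & forall y, span A y -> c y = 0].
Proof.
move=> nAx.
have [A0 [A0A fA0 _ AA0]] := extend_free A (@free_set0 _ V).
rewrite set0U in fA0 AA0.
have nA0x : ~ span A0 x by move=> /(span_sub A0A).
have [C [_ bC CA]] := @extend_to_basis (x |` A0) setT (free_add fA0 nA0x)
  (fun y => span_in (or_intror I)).
have Bx : ((x |` A0) `|` C) x by left; left.
exists (coord ((x |` A0) `|` C) x); split; first exact: coord_lin.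
  by apply: coordx.
move=> y sy; apply: coord0 => //.
have A0y : span A0 y by apply: span_trans sy.
apply: span_sub A0y => z A0z; split; first by left; right.
by move=> /= zx; apply: nA0x; rewrite -zx; apply: span_in.
Qed.

End Coord.

(** * Cardinals and dimensions *)

Definition embeds (T U : Type) (A : set T) (B : set U) : Prop :=
  exists f : T -> U, (forall x, A x -> B (f x)) /\
    (forall x y, A x -> A y -> f x = f y -> x = y).

Lemma embeds_trans (T U W : Type) (A : set T) (B : set U) (C : set W) :
  embeds A B -> embeds B C -> embeds A C.
Proof.
move=> [f [AB fi]] [g [BC gi]]; exists (g \o f).
split=> [x /AB/BC //|x y Ax Ay /gi /fi]; apply=> //; exact: AB.
Qed.

Lemma embeds_sub (T : Type) (A B : set T) : A `<=` B -> embeds A B.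
Proof. by move=> AB; exists id; split. Qed.

(** The point [u0] rules out an empty codomain type, into which no total function need exist. *)
Lemma card_le_embeds (T U : Type) (A : set T) (B : set U) (u0 : U) :
  (A #<= B)%card <-> embeds A B.
Proof.
split=> [|[f [AB fi]]]; last first.
  apply: (@card_le_trans _ _ _ (f @` A)).
    have /card_eqPle[] // : (f @` A #= A)%card.
    by apply: inj_card_eq => x y; rewrite !inE; apply: fi.
  by apply: subset_card_le => _ [x Ax <-]; apply: AB.
elim/Ppointed: U => U in B u0 *; first by case: (no u0).
move=> /pcard_leP[f]; exists f; split=> [x Ax|x y Ax Ay]; first exact: funS.
by apply: inj; rewrite inE.
Qed.

Lemma finite_embeds (T U : Type) (A : set T) (B : set U) (u0 : U) :
  embeds A B -> finite_set B -> finite_set A.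
Proof. by move=> /(card_le_embeds _ _ u0); apply: card_le_finite. Qed.

(** A maximal family [X] of disjoint injective sequences in [B] leaves a finite remainder, so [B]
    injects into the product of [X] and [nat]; pairs of integers are then coded as positions inside
    each sequence. *)
Lemma infinite_mul_nat (T : choiceType) (B : set T) : infinite_set B ->
  exists t : T -> nat -> T, (forall x n, B x -> B (t x n)) /\
    (forall x y n m, B x -> B y -> t x n = t y m -> x = y /\ n = m).
Proof.
move=> Binf.
pose P := [set X : set (nat -> T) | (forall f n, X f -> B (f n)) /\
  (forall f g n m, X f -> X g -> f n = g m -> f = g /\ n = m)].
have [Ch FP Ftot|X [[XB Xi] Xmax]] := @Zorn_bigcup _ P.
  split; first by move=> f n [Y /FP[YB _] Yf]; apply: YB.
  move=> f g n m [Y FY Yf] [Z FZ Zg].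
  have [YZ|ZY] := Ftot _ _ FY FZ.
    by have [_] := FP _ FZ; apply=> //; apply: YZ.
  by have [_] := FP _ FY; apply=> //; apply: ZY.
pose rest := [set x | B x /\ forall f n, X f -> f n <> x].
have /finite_seqP[s rests] : finite_set rest.
  have [b0 _] := infinite_setN0 Binf.
  apply: contrapT => /infiniteP/(card_le_embeds _ _ b0)[f [fB finj]].
  have fr n : rest (f n) by apply: fB.
  have fi n m : f n = f m -> n = m by apply: finj.
  have nXf : ~ X f by move=> Xf; have [_ /(_ f 0%N Xf)] := fr 0%N.
  apply: (Xmax ((f : nat -> T) |` X)).
    split; first by move=> g; right.
    by move=> /(_ f (or_introl erefl)).
  split; first by move=> g n [->|/XB//]; have [] := fr n.
  move=> g h n m [->|Xg] [->|Xh].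
  - by move=> /fi.
  - by move=> /esym e; have [_ /(_ h m Xh)] := fr n.
  - by move=> e; have [_ /(_ g n Xg)] := fr m.
  - exact: Xi.
have [f0 Xf0] : exists f, X f.
  apply: contrapT => nX; apply: Binf; apply/finite_seqP; exists s.
  rewrite -rests; apply/seteqP; split=> x; last by case.
  by move=> Bx; split=> // f n Xf; case: nX; exists f.
(* [c x] is a sequence with a position; positions are shifted by [size s] to make room for the
   remainder [s] at the beginning of [f0]. *)
have /choice[c cP] : forall x, exists p : (nat -> T) * nat, B x -> X p.1 /\
    ((x \in s /\ p = (f0, index x s)) \/
     exists2 k, p.1 k = x & p.2 = (k + size s)%N).
  move=> x; have [Bx|nBx] := pselect (B x); last by exists (f0, 0%N).
  have [xs|xs] := boolP (x \in s).
    by exists (f0, index x s) => _; split=> //; left.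
  have : ~ rest x by rewrite rests /= => xs'; rewrite xs' in xs.
  move=> nrest.
  have [f [n [Xf fn]]] : exists f n, X f /\ f n = x.
    apply: contrapT => nf; apply: nrest; split=> // f n Xf fn.
    by apply: nf; exists f, n.
  by exists (f, (n + size s)%N) => _; split=> //; right; exists n.
have ci x y : B x -> B y -> c x = c y -> x = y.
  move=> Bx By; have [_ cx] := cP x Bx; have [_ cy] := cP y By => cxy.
  move: cx; rewrite cxy => -[[xs cx]|[k <- k2]].
    case: cy => [[ys cy]|[l _]].
      by move: cx; rewrite cy => -[] /index_inj -> //.
    by rewrite cx /= => e; move: xs; rewrite -index_mem e ltnNge leq_addl.
  case: cy => [[ys cy]|[l e l2]].
    by move: ys; rewrite -index_mem; move: k2; rewrite cy /= => ->; rewrite ltnNge leq_addl.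
  by rewrite -[RHS]e; congr ((c y).1 _); apply: (@addIn (size s)); rewrite -k2.
exists (fun x n => (c x).1 (pickle ((c x).2, n))); split.
  by move=> x n Bx; apply: XB; have [] := cP x Bx.
move=> x y n m Bx By.
have [Xx _] := cP x Bx; have [Xy _] := cP y By.
move=> /(Xi _ _ _ _ Xx Xy)[e1 /(pcan_inj pickleK)[e2 ->]]; split=> //.
by apply: ci => //; move: e1 e2; case: (c x) (c y) => [? ?] [? ?] /= -> ->.
Qed.

(* Zorn's lemma on the partial injections [G] from [C] to [A] such that replacing
   [dom G] by [ran G] in [C] keeps [C] free. *)
Lemma steinitz (F : fieldType) (V : lmodType F) (C A : set V) :
  free C -> (forall x, C x -> span A x) -> embeds C A.
Proof.
move=> fC CA.
pose R (G : set (V * V)) := [set x | (exists c, G (c, x)) \/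
  (C x /\ forall a, ~ G (x, a))].
(* By the last clause, no vector is both a replacement and a vector of [C] still to be replaced. *)
pose P := [set G : set (V * V) | [/\ (forall c a, G (c, a) -> C c /\ A a),
  (forall c a a', G (c, a) -> G (c, a') -> a = a'),
  (forall c c' a, G (c, a) -> G (c', a) -> c = c'),
  free (R G) & (forall c a, G (c, a) -> C a -> exists a', G (a, a'))]].
have [Ch FP Ftot|G [[GCA Gfun Ginj Gfree Gdis] Gmax]] := @Zorn_bigcup _ P.
  split.
  - by move=> c a [X /FP[h _ _ _ _] /h].
  - move=> c a a' [X FX Xa] [Y FY Ya].
    have [XY|YX] := Ftot _ _ FX FY.
      by have [_ h _ _ _] := FP _ FY; apply: (h c) => //; apply: XY.
    by have [_ h _ _ _] := FP _ FX; apply: (h c) => //; apply: YX.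
  - move=> c a a' [X FX Xa] [Y FY Ya].
    have [XY|YX] := Ftot _ _ FX FY.
      by have [_ _ h _ _] := FP _ FY; apply: h Ya; apply: XY.
    by have [_ _ h _ _] := FP _ FX; apply: h Xa _; apply: YX.
  - have [F0|/set0P/negP/negbNE/eqP->] := pselect (Ch !=set0); last first.
      apply: free_sub fC => x [[c]|[//]]; by rewrite bigcup_set0.
    pose U := \bigcup_(X in Ch) X; rewrite -/U.
    move=> x xU /span_fin[s sU sx].
    pose Q (X : set (V * V)) y := (exists c, X (c, y)) \/
      (C y /\ forall a, ~ U (y, a)).
    have Qmono X Y y : X `<=` Y -> Q X y -> Q Y y.
      by move=> XY [[c /XY Yc]|?]; [left; exists c|right].
    have [|X FX XQ] := @total_on_seq _ V Ch Q (x :: s) Ftot F0 Qmono.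
      move=> y yxs; have : R U y by case/predU1P: yxs => [-> //|/sU[]].
      case=> [[c [X FX Xc]]|h]; first by exists X => //; left; exists c.
      by have [X FX] := F0; exists X => //; right.
    have QR y : Q X y -> R X y.
      case=> [|[Cy h]]; [by left|right; split=> // a Xa].
      by apply: (h a); exists X.
    have [_ _ _ fX _] := FP _ FX; apply: (fX x); first exact/QR/XQ/mem_head.
    apply: span_sub sx => y /= ys; split; last by have [] := sU _ ys.
    by apply/QR/XQ; rewrite inE ys orbT.
  - move=> c a [X FX Xca] Ca; have [_ _ _ _ h] := FP _ FX.
    by have [a' Xa] := h _ _ Xca Ca; exists a', X.
have Gtot c : C c -> exists a, G (c, a).
  move=> Cc; apply: contrapT => nG.
  have nGc a : ~ G (c, a) by move=> Ga; apply: nG; exists a.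
  have Rc : R G c by right.
  (* If [A] were in the span of [R G] without [c], then so would [c], against the freeness of
     [R G]. *)
  have [a [Aa nDa]] : exists a, A a /\ ~ span (R G `\ c) a.
    apply: contrapT => h; apply: (Gfree _ Rc); apply: span_trans (CA c Cc).
    by move=> a Aa; apply: contrapT => na; apply: h; exists a.
  have nranc d : ~ G (d, c).
    by move=> /Gdis /(_ Cc)[a' Ga']; apply: (nGc a').
  have nrana d : ~ G (d, a).
    move=> Ga; apply: nDa; apply: span_in; split; first by left; exists d.
    by move=> /= ac; rewrite ac in Ga; apply: (nranc d).
  apply: (Gmax ((c, a) |` G)).
    split; first by move=> p; right.
    by move=> /(_ (c, a) (or_introl erefl)); apply: nGc.
  split.
  - by move=> c' a' [[-> ->] //|/GCA].
  - move=> c' a1 a2 [[-> ->]|G1] [[e1]|G2].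
    + by rewrite e1.
    + by case: (nGc a2).
    + by rewrite e1 in G1; case: (nGc a1).
    + exact: Gfun G1 G2.
  - move=> c1 c2 a' [[-> ->]|G1] [[e1]|G2].
    + by rewrite e1.
    + by case: (nrana c2).
    + by move=> e2; rewrite e2 in G1; case: (nrana c1).
    + exact: Ginj G1 G2.
  - apply: (@free_sub _ _ _ (a |` (R G `\ c))); last first.
      by apply: free_add nDa; apply: free_sub Gfree => x [].
    move=> x [[d [[_ ->]|Gd]]|[Cx nGx]].
    + by left.
    + right; split; first by left; exists d.
      by move=> /= xc; rewrite xc in Gd; apply: (nranc d).
    + right; split; first by right; split=> // b Gb; apply: (nGx b); right.
      by move=> /= xc; apply: (nGx a); left; rewrite xc.
  - move=> c' a' [[_ ->] Ca|Gca Ca'].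
      have [ac|/eqP ac] := eqVneq a c; first by exists a; left; rewrite ac.
      apply: contrapT => h; apply: nDa; apply: span_in; split=> //.
      by right; split=> // b Gb; apply: h; exists b; right.
    by have [b Gb] := Gdis _ _ Gca Ca'; exists b; right.
have /choice[f fP] : forall c, exists a, C c -> G (c, a).
  move=> c; have [Cc|nCc] := pselect (C c); last by exists 0.
  by have [a Ga] := Gtot c Cc; exists a.
exists f; split=> [c /fP/GCA[]//|c c' /fP Gc /fP Gc' e].
by apply: Ginj Gc _; rewrite e.
Qed.

(** * Swaps *)

Section Criterion.
Variables (F : fieldType) (V : lmodType F).
Hypothesis c2 : forall x : V, x + x = 0.

(* Intended for a projection [d]: [u \o d] is a sum of three idempotents that live
   on the range of [d] and vanish on its kernel. *)
Definition idem3 (d u : V -> V) : Prop := exists e1 e2 e3 : V -> V,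
  [/\ forall x, u (d x) = e1 x + e2 x + e3 x &
    forall e, e = e1 \/ e = e2 \/ e = e3 ->
      [/\ lin e, forall x, e (e x) = e x, forall x, d (e x) = e x &
        forall x, e (d x) = e x]].

Lemma char2_opp (x : V) : - x = x.
Proof. by apply: (addrI x); rewrite subrr c2. Qed.

(** The relation [p N + N p = N] says that [N] maps the range and the kernel of [p] into each other;
    in particular [p N p = 0]. *)
Lemma swap_idem (p N : V -> V) : lin p -> lin N ->
  (forall x, p (p x) = p x) -> (forall x, p (N x) + N (p x) = N x) ->
  forall x, let e := fun y => p y + p (N y) in e (e x) = e x.
Proof.
move=> pl Nl pp pN x /=.
have pNp y : p (N (p y)) = 0.
  by apply: (addrI (p (N y))); rewrite -{1}[p (N y)]pp -(linD pl) pN addr0.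
by rewrite (linD pl) !pp (linD Nl) (linD pl) !pNp !addr0.
Qed.

Lemma idem3_swap (d u e p N : V -> V) :
  lin d -> lin e -> lin p -> lin N ->
  (forall x, d (d x) = d x) ->
  (forall x, d (e x) = e x) -> (forall x, e (d x) = e x) ->
  (forall x, d (p x) = p x) -> (forall x, p (d x) = p x) ->
  (forall x, d (N x) = N x) -> (forall x, N (d x) = N x) ->
  (forall x, e (e x) = e x) -> (forall x, p (p x) = p x) ->
  (forall x, p (N x) + N (p x) = N x) ->
  (forall x, u (d x) = e x + N x) -> idem3 d u.
Proof.
move=> dl el pl Nl dd de ed dp pd dN Nd ee pp pN ueN.
pose q x := d x - p x.
have ql : lin q by apply: lin_sub.
have qq x : q (q x) = q x.
  by rewrite /q (linB dl) (linB pl) dd dp pd pp subrr subr0.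
have qN x : q (N x) + N (q x) = N x.
  by rewrite /q (linB Nl) dN Nd addrACA -opprD pN addrK.
exists (fun x => p x + p (N x)), (fun x => q x + q (N x)), (fun x => e x - d x).
split=> [x|f].
  rewrite [p x + _ + _]addrACA /q dN [p x + _]addrC subrK [p (N x) + _]addrC subrK.
  by rewrite ueN [RHS]addrC addrA subrK.
case=> [->|[->|->]]; split.
- by apply: lin_add => //; apply: lin_comp.
- exact: swap_idem.
- by move=> x; rewrite (linD dl) !dp.
- by move=> x; rewrite pd Nd.
- by apply: lin_add => //; apply: lin_comp.
- exact: swap_idem.
- by move=> x; rewrite (linD dl) /q !(linB dl) !dd !dp.
- by move=> x; rewrite /q dd pd Nd.
- exact: lin_sub.
- by move=> x; rewrite (linB el) (linB dl) ee ed de dd subrr add0r char2_opp.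
- by move=> x; rewrite (linB dl) de dd.
- by move=> x; rewrite ed dd.
Qed.

End Criterion.

(** * Shifts perturbed by lower terms are swaps *)

Section Graded.
Variables (F : fieldType) (V : lmodType F) (B : set V) (Bb : basis B).
Variables (v : V -> V) (lev : V -> nat) (D : set V) (L : V -> V).

Let lower n := [set b | B b /\ (lev b < n)%N].

Hypotheses (vl : lin v) (DB : D `<=` B) (LB : forall c, D c -> B (L c))
  (lt_lev : forall c, D c -> (lev c < lev (L c))%N)
  (vL : forall c, D c -> span (lower (lev (L c))) (v c - L c))
  (Linj : forall c c', D c -> D c' -> L c = L c' -> c = c')
  (nD : forall b, B b -> ~ D b -> v b = 0 /\ forall c, D c -> L c <> b).

(* [D] carries the injection [L], which raises levels, and [v c] is [L c] plus terms
   of lower level, so that [v] is conjugate to the shift [c |-> L c]. The equation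
   [p v = v - v p] determines [p] by recursion on the level, starting from [p = 0]
   outside the image of [L]. *)
Lemma graded_proj : exists p : V -> V,
  [/\ lin p, forall x, p (p x) = p x & forall x, p (v x) + v (p x) = v x].
Proof.
have /choice[pre preP] : forall b, exists o : option V,
    if o is Some c then D c /\ L c = b else forall c, D c -> L c <> b.
  move=> b; have [[c [Dc Lc]]|h] := pselect (exists c, D c /\ L c = b).
    by exists (Some c).
  by exists None => c Dc Lc; apply: h; exists c.
(* For [b = L c] this is [p (v c) = v c - v (p c)] solved for [p b]; it calls [p] only below the
   level of [b]. *)
pose val (p : V -> V) b :=
  if pre b is Some c then v c - v (p c) - p (v c - b) else 0.
(* [P n] is stationary at [b] once [n] exceeds [lev b], whence the fuel [(lev b).+1] in [p]. *)
pose P := fix P n := if n is n'.+1 then ext Bb (val (P n')) else (fun=> 0).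
have Pl n : lin (P n) by case: n => [|n]; [apply: lin_zero|apply: ext_lin].
have agree (f g : V -> V) n : lin f -> lin g ->
    (forall b, B b -> (lev b < n)%N -> f b = g b) ->
    forall x, span (lower n) x -> f x = g x.
  move=> fl gl fg x; elim=> [|a y z [By ly] _ IHz]; first by rewrite !lin0.
  by rewrite fl gl fg // IHz.
have val_agree (f g : V -> V) b : lin f -> lin g -> B b ->
    (forall c, B c -> (lev c < lev b)%N -> f c = g c) -> val f b = val g b.
  move=> fl gl Bb' fg; rewrite /val; case: (pre b) (preP b) => // c [Dc Lc].
  rewrite fg ?(agree _ _ _ fl gl fg) -?Lc //; [exact: vL|exact: DB|exact: lt_lev].
have PS n b : B b -> (lev b < n)%N -> P n b = P n.+1 b.
  elim: n b => // n IHn b Bb' ln.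
  rewrite /= !ext_on_basis //; apply: val_agree => // [|c Bc lc].
    exact: ext_lin.
  by rewrite IHn //; apply: leq_trans lc ln.
pose p := ext Bb (fun b => P (lev b).+1 b).
have pl : lin p by apply: ext_lin.
have pP n b : B b -> (lev b < n)%N -> p b = P n b.
  move=> Bb' /subnK <-; rewrite /p ext_on_basis //.
  elim: (n - _)%N => // k IHk; rewrite IHk; apply: PS => //.
  by rewrite addnS ltnS leq_addl.
have pval b : B b -> p b = val p b.
  move=> Bb'; rewrite (pP (lev b).+1) //= ext_on_basis //.
  by apply: val_agree => // c Bc lc; rewrite (pP (lev b)).
have pv x : p (v x) + v (p x) = v x.
  move: x; apply: (eq_on_basis Bb) => // [|c Bc].
    by apply: lin_add; apply: lin_comp.
  have [Dc|nDc] := pselect (D c); last first.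
    have [vc nLc] := nD Bc nDc; rewrite vc (lin0 pl) add0r pval // /val.
    case: (pre c) (preP c) => [c' [Dc' Lc']|_]; last by rewrite (lin0 vl).
    by case: (nLc c').
  have := pval _ (LB Dc); rewrite /val.
  case: (pre (L c)) (preP (L c)) => [c' [Dc' /(Linj Dc' Dc) ->]|/(_ c Dc)//].
  move=> e; have ev : v c = (v c - L c) + L c by rewrite subrK.
  by rewrite {1}ev (linD pl) e [p _ + _]addrC !subrK.
(* Induction on the level: [p v = v - v p] and [p (p c) = p c] show that [p] fixes
   [v c - v (p c)]. *)
exists p; split=> // x; move: x.
apply: (eq_on_basis Bb) => //; first exact: lin_comp.
move=> b; have [n] := ubnP (lev b); elim: n b => // n IHn b ln Bb'.
have low c : D c -> L c = b -> p (p (v c - b)) = p (v c - b).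
  move=> Dc Lc; apply: (agree (p \o p) p (lev b)) => //; first exact: lin_comp.
    by move=> d Bd ld; apply: IHn => //; apply: leq_trans ld _; rewrite -ltnS.
  by rewrite -Lc; apply: vL.
rewrite (pval b) // /val; case: (pre b) (preP b) => [c [Dc Lc]|_].
  have ppc : p (p c) = p c.
    apply: IHn; last exact: DB.
    by rewrite -ltnS; apply: leq_trans ln; rewrite ltnS -Lc lt_lev.
  have pvE y : p (v y) = v y - v (p y) by rewrite -[v y in RHS]pv addrK.
  by rewrite (linB pl (v c - v (p c))) (linB pl _ (v (p c))) low // !pvE ppc subrr subr0.
by rewrite (lin0 pl).
Qed.

End Graded.

(** * Endomorphisms of infinite rank *)

Section Pairs.
Variables (F : fieldType) (V : lmodType F).
Hypothesis c2 : forall x : V, x + x = 0.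
Variables (u : V -> V) (ul : lin u).

Lemma span_level (B : set V) (lev : V -> nat) y : span B y ->
  exists n, forall m, (n <= m)%N -> span [set b | B b /\ (lev b < m)%N] y.
Proof.
elim=> [|a b z Bb _ [n zn]]; first by exists 0%N => m _; apply: span0.
exists (maxn n (lev b).+1) => m; rewrite geq_max => /andP[nm bm].
by apply: spanP; [split|apply: zn].
Qed.

Definition pairs (S : set V) : Prop :=
  [/\ forall s s', S s -> S s' -> u s = u s' -> s = s',
      forall s s', S s -> S s' -> u s <> s' & free (S `|` u @` S)].

(** Since [S] is infinite and dominates [X], it contains disjoint sequences [t b 0, t b 1, ...], one
    for each [b] in [O], and [m b] is a late term of the sequence of [b]. Then [graded_proj] applies
    to [u - e], with [L] sending [s] in [S] to [u s] and [b] in [O] to [m b]. *)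
Lemma idem3_pairs (S X : set V) : pairs S -> infinite_set S -> embeds X S ->
  (forall x, span (X `|` [set y | u y = 0]) x) -> idem3 id u.
Proof.
move=> [ui uS fS] Sinf [f [fX fi]] sX.
have [T [TX Bb TS]] := extend_to_basis (G := X `|` [set y | u y = 0]) fS
  (fun x => span_sub (@subsetUr _ _ _) (sX x)).
set B := (S `|` u @` S) `|` T in Bb.
pose O x := (u @` S) x \/ (T x /\ u x <> 0).
have OB x : O x -> B x by case=> [h|[h _]]; [left; right|right].
have OX x : O x -> (u @` S) x \/ X x.
  by case=> [|[/TX[|]]]; [left|right|].
have nSO x : S x -> ~ O x.
  move=> Sx [[s Ss us]|[Tx _]]; first exact: (uS s x).
  by apply: (TS _ Tx); left.
have [t0 [t0S t0i]] := infinite_mul_nat Sinf.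
have [s0 Ss0] := infinite_setN0 Sinf.
have /choice[h hP] : forall x, exists y, O x ->
    (exists s, [/\ S s, u s = x & y = t0 s 0%N]) \/
    (X x /\ y = t0 (f x) 1%N).
  move=> x; have [Ox|nOx] := pselect (O x); last by exists 0.
  have [[s Ss us]|Xx] := OX _ Ox.
    by exists (t0 s 0%N) => _; left; exists s.
  by exists (t0 (f x) 1%N) => _; right.
have hS x : O x -> S (h x).
  by move=> /hP[[s [Ss _ ->]]|[Xx ->]]; apply: t0S => //; apply: fX.
have hi x y : O x -> O y -> h x = h y -> x = y.
  move=> /hP hx /hP; case: hx => [[s [Ss <- ->]]|[Xx ->]].
    case=> [[s' [Ss' <- ->]]|[Xy ->]].
      by move=> /(t0i _ _ _ _ Ss Ss')[->].
    by move=> /(t0i _ _ _ _ Ss (fX _ Xy))[_].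
  case=> [[s' [Ss' <- ->]]|[Xy ->]].
    by move=> /(t0i _ _ _ _ (fX _ Xx) Ss')[_].
  by move=> /(t0i _ _ _ _ (fX _ Xx) (fX _ Xy))[e _]; apply: fi.
pose t x n := t0 (h x) n.
have tS x n : O x -> S (t x n) by move=> Ox; apply/t0S/hS.
have ti x y n m : O x -> O y -> t x n = t y m -> x = y /\ n = m.
  by move=> Ox Oy /(t0i _ _ _ _ (hS _ Ox) (hS _ Oy))[e ->]; split=> //; apply: hi.
have /choice[lv lvP] : forall s, exists n, forall x m, O x -> t x m = s -> m = n.
  move=> s; have [[x [n [Ox xn]]]|ns] := pselect (exists x n, O x /\ t x n = s).
    by exists n => y m Oy; rewrite -xn => /(ti _ _ _ _ Oy Ox)[].
  by exists 0%N => x m Ox xm; case: ns; exists x, m.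
have lvt x n : O x -> lv (t x n) = n by move=> Ox; rewrite -(lvP _ x n).
(* Even levels on [S], odd ones on [u(S)]: [u s] sits just above [s]. The vectors of [T] get level
   0. *)
have /choice[lev levP] : forall b, exists n, (S b -> n = (lv b).*2) /\
    (forall s, S s -> u s = b -> n = (lv s).*2.+1).
  move=> b; have [Sb|nSb] := pselect (S b).
    by exists (lv b).*2; split=> // s Ss us; case: (uS s b).
  have [[s Ss us]|ns] := pselect ((u @` S) b).
    by exists (lv s).*2.+1; split=> // s' Ss'; rewrite -us => /(ui _ _ Ss' Ss) ->.
  by exists 0%N; split=> // s Ss us; case: ns; exists s.
have levS s : S s -> lev s = (lv s).*2 by move=> Ss; apply: (levP s).1.
have levuS s : S s -> lev (u s) = (lv s).*2.+1 by move=> Ss; apply: (levP (u s)).2.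
have /choice[nb nbP] : forall b, exists n, (lev b < n.*2)%N /\
    span [set c | B c /\ (lev c < n.*2)%N] (u b - b).
  move=> b; have [n hn] := span_level lev (Bb.2 (u b - b)).
  exists (maxn n (lev b).+1); split.
    by rewrite -addnn (leq_trans _ (leq_addl _ _)) // leq_maxr.
  by apply: hn; rewrite -addnn (leq_trans _ (leq_addl _ _)) // leq_maxl.
pose m b := t b (nb b).
pose e := ext Bb (fun b => if pselect (O b) then b - m b else 0).
have el : lin e by apply: ext_lin.
have eO b : O b -> e b = b - m b.
  by move=> Ob; rewrite /e ext_on_basis //; [case: pselect|apply: OB].
have enO b : B b -> ~ O b -> e b = 0.
  by move=> Bb' nOb; rewrite /e ext_on_basis //; case: pselect.
have SB s : S s -> B s by left; left.
have mS b : O b -> S (m b) by apply: tS.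
have em b : O b -> e (m b) = 0.
  by move=> Ob; apply: enO; [apply/SB/mS|apply/nSO/mS].
have ee x : e (e x) = e x.
  move: x; apply: (eq_on_basis Bb) => // [|b Bb']; first exact: lin_comp.
  have [Ob|nOb] := pselect (O b); last by rewrite (enO b) // (lin0 el).
  by rewrite (eO b) // (linB el) eO // em // subr0.
pose D b := S b \/ O b.
pose L b := if pselect (S b) then u b else m b.
have LS b : S b -> L b = u b by rewrite /L; case: pselect.
have LO b : O b -> L b = m b.
  by move=> Ob; rewrite /L; case: pselect => // Sb; case: (nSO b Sb).
pose v x := u x - e x.
have vl : lin v by apply: lin_sub.
have vS s : S s -> v s = u s.
  by move=> Ss; rewrite /v enO ?subr0 //; [apply: SB|apply: nSO].
have vO b : O b -> v b = m b + (u b - b).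
  by move=> Ob; rewrite /v eO // opprB addrCA.
have levm b : O b -> lev (m b) = (nb b).*2.
  by move=> Ob; rewrite levS ?lvt //; apply: mS.
have uSO s : S s -> O (u s) by left; exists s.
have [||||||p [pl pp pv]] := @graded_proj _ _ B Bb v lev D L vl.
- by move=> b [/SB|/OB].
- move=> b [Sb|Ob]; first by rewrite LS //; apply/OB/uSO.
  by rewrite LO //; apply/SB/mS.
- move=> b [Sb|Ob]; first by rewrite LS // levuS // levS.
  by rewrite LO // levm //; have [] := nbP b.
- move=> b [Sb|Ob]; first by rewrite LS // vS // subrr; apply: span0.
  by rewrite LO // vO // addrC addKr levm //; have [] := nbP b.
- move=> b c [Sb|Ob] [Sc|Oc].
  + by rewrite !LS //; apply: ui.
  + rewrite LS // LO // => eq; case: (nSO (m c)); first exact: mS.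
    by rewrite -eq; apply: uSO.
  + rewrite LO // LS // => eq; case: (nSO (m b)); first exact: mS.
    by rewrite eq; apply: uSO.
  + by rewrite !LO // => /(ti _ _ _ _ Ob Oc)[].
- move=> b Bb' nDb.
  have [Tb ub] : T b /\ u b = 0.
    case: Bb' => [[Sb|uSb]|Tb]; [by case: nDb; left|by case: nDb; right; left|].
    by split=> //; apply: contrapT => ub; case: nDb; right; right.
  split; first by rewrite /v ub enO ?subrr //; move=> Ob; apply: nDb; right.
  move=> c [Sc|Oc].
    by rewrite LS // => eq; apply: (TS _ Tb); right; exists c.
  by rewrite LO // => eq; apply: (TS _ Tb); left; rewrite -eq; apply: mS.
apply: (@idem3_swap _ _ c2 id u e p v) => //.
by move=> x; rewrite /v addrC subrK.
Qed.

(* By maximality, every [y] outside [W = span (S U u(S))] satisfies [u y = l y] modulo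
   [W] for some [l]; when [V / W] has dimension at least 2, [l] does not depend on [y]
   and [W] is stable. *)
Lemma max_pairs : exists S, pairs S /\
  ((exists l, forall x, span (S `|` u @` S) (u x - l *: x)) \/
   (exists y, forall x, span (y |` (S `|` u @` S)) x)).
Proof.
pose Q X (x : V) := X x \/ exists2 s, X s & u s = x.
have Qmono (X Y : set V) x : X `<=` Y -> Q X x -> Q Y x.
  by move=> XY [/XY|[s /XY Ys us]]; [left|right; exists s].
have [Ch FP Ftot|S [[ui uS fS] Smax]] := @Zorn_bigcup _ pairs.
  split.
  - move=> s s' [X FX Xs] [Y FY Ys'].
    have [XY|YX] := Ftot _ _ FX FY.
      by have [h _ _] := FP _ FY; apply: h => //; apply: XY.
    by have [h _ _] := FP _ FX; apply: h => //; apply: YX.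
  - move=> s s' [X FX Xs] [Y FY Ys'].
    have [XY|YX] := Ftot _ _ FX FY.
      by have [_ h _] := FP _ FY; apply: h => //; apply: XY.
    by have [_ h _] := FP _ FX; apply: h => //; apply: YX.
  - have [F0|/set0P/negP/negbNE/eqP->] := pselect (Ch !=set0); last first.
      by rewrite bigcup_set0 image_set0 setU0; apply: free_set0.
    move=> x xU /span_fin[s sU sx].
    have [|X FX XQ] := @total_on_seq _ V Ch Q (x :: s) Ftot F0 Qmono.
      move=> y yxs.
      have : ((\bigcup_(X in Ch) X) `|` u @` (\bigcup_(X in Ch) X)) y.
        by case/predU1P: yxs => [-> //|/sU[]].
      case=> [[X FX Xy]|[z [X FX Xz] uz]]; first by exists X => //; left.
      by exists X => //; right; exists z.
    have QX y : Q X y -> (X `|` u @` X) y.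
      by case=> [|[z Xz uz]]; [left|right; exists z].
    have [_ _ fX] := FP _ FX; apply: (fX x); first exact/QX/XQ/mem_head.
    apply: span_sub sx => y /= ys; split; last by have [] := sU _ ys.
    by apply/QX/XQ; rewrite inE ys orbT.
set W := S `|` u @` S in fS.
have tri (a b c : V) : a + b - (a - c) = c + b.
  by rewrite opprB addrC addrA subrK.
exists S; split; first by split.
apply: contrapT => /not_orP[nl ny].
have key y : ~ span W y -> exists l, span W (u y - l *: y).
  move=> nWy; apply: contrapT => nl'.
  have nWy' : ~ span (y |` W) (u y).
    by move=> /span_exch[a h]; apply: nl'; exists a.
  have nSy : ~ S y by move=> Sy; apply: nWy; apply: span_in; left.
  have nuSy s : S s -> u s <> y.
    by move=> Ss us; apply: nWy; apply: span_in; right; exists s.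
  have nuy s : S s -> u s <> u y.
    by move=> Ss us; apply: nWy'; apply: span_in; right; right; exists s.
  apply: (Smax (y |` S)).
    split; first by move=> s; right.
    by move=> /(_ y (or_introl erefl)).
  split.
  - move=> s s' [->|Ss] [->|Ss'] //.
    + by move=> /esym /nuy.
    + by move=> /nuy.
    + exact: ui.
  - move=> s s' [->|Ss] [->|Ss'].
    + by move=> e; apply: nWy'; rewrite e; apply: span_in; left.
    + by move=> e; apply: nWy'; rewrite e; apply: span_in; right; left.
    + exact: nuSy.
    + exact: uS.
  - apply: (@free_sub _ _ _ (u y |` (y |` W))); last by do 2?apply: free_add.
    move=> x [[->|Sx]|[s [->|Ss] <-]]; [by right; left|by right; right; left|by left|].
    by right; right; right; exists s.
have [y nWy] : exists y, ~ span W y.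
  apply: contrapT => h; apply: ny; exists 0 => x; apply: (@span_sub _ _ W).
    by move=> z; right.
  by apply: contrapT => nx; apply: h; exists x.
have [y' nWy'] : exists y', ~ span (y |` W) y'.
  by apply: contrapT => h; apply: ny; exists y => x; apply: contrapT => nx;
    apply: h; exists x.
have sWy z x : span W x -> span (z |` W) x.
  by apply: span_sub => w; right.
have sy z : span (z |` W) z by apply: span_in; left.
have nW' : ~ span W y' by move=> /(sWy y).
have nWD z : ~ span (y |` W) (y' + z *: y).
  move=> h; apply: nWy'; rewrite -[y'](addrK (z *: y)).
  by apply: spanB => //; apply: spanZ.
have nWD1 : ~ span W (y' + y) by move=> /(sWy y); rewrite -[y in y' + y]scale1r => /nWD.
have [l hl] := key y nWy; have [l' hl'] := key y' nW'.
(* Both are compared with the eigenvalue [k] of [y + y'] modulo [W], as [y] and [y'] are independent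
   modulo [W]. *)
have ll' : l' = l.
  have [k hk] := key _ nWD1.
  have : span W ((k - l') *: y' + (k - l) *: y).
    have -> : (k - l') *: y' + (k - l) *: y =
        (u y' - l' *: y') + (u y - l *: y) - (u (y' + y) - k *: (y' + y)).
      by rewrite (linD ul) scalerDr !scalerBl addrACA [in RHS]addrACA tri.
    by apply: spanB => //; apply: spanD.
  move=> h.
  have kl' : k = l'.
    apply/eqP; rewrite -subr_eq0; apply/negPn/negP => n0.
    apply: (nWD ((k - l')^-1 * (k - l))).
    rewrite -scalerA -[y']scale1r -(mulVf n0) -scalerA -scalerDr.
    exact/spanZ/sWy.
  move: h; rewrite kl' subrr scale0r add0r => h.
  apply/eqP; rewrite -subr_eq0; apply/negPn/negP => n0; apply: nWy.
  by rewrite -[y]scale1r -(mulVf n0) -scalerA; apply: spanZ.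
rewrite {}ll' in hl'.
(* For [x] outside [W], both [x] and [z + x] are eigenvectors modulo [W], so [u z] lies in [W] plus
   the line of [x]; take [x = y] and [x = y']. *)
have uW z : span W z -> span W (u z).
  move=> Wz.
  have aux x : ~ span W x -> span (x |` W) (u z).
    move=> nx; have nzx : ~ span W (z + x).
      by move=> h; apply: nx; rewrite -[x](addKr z); apply: spanD h; apply: spanN.
    have [k hk] := key _ nzx; have [k' hk'] := key _ nx.
    have -> : u z = (u (z + x) - k *: (z + x)) - (u x - k' *: x) + k *: (z + x) - k' *: x.
      rewrite addrAC opprB [k' *: x - _]addrC addrA addrK addrAC subrK.
      by rewrite (linD ul) addrK.
    apply: spanB; last exact: spanZ.
    apply: spanD; first by apply: sWy; apply: spanB.
    by apply: spanZ; apply: spanD => //; apply: sWy.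
  have /span_exch[a ha] := aux _ nWy.
  have [a0|a0] := eqVneq a 0; first by move: ha; rewrite a0 scale0r subr0.
  have /span_exch[b hb] := aux _ nW'.
  exfalso; apply: nWy'.
  have [b0|b0] := eqVneq b 0.
    exfalso; apply: nWy; rewrite -[y]scale1r -(mulVf a0) -scalerA; apply: spanZ.
    rewrite -[a *: y](subKr (u z)); apply: spanB => //.
    by move: hb; rewrite b0 scale0r subr0.
  rewrite -[y']scale1r -(mulVf b0) -scalerA; apply: spanZ.
  rewrite -[b *: y'](subKr (u z)); apply: spanB; last exact: sWy.
  by rewrite -[u z](subrK (a *: y)); apply: spanD; [apply: sWy|apply: spanZ].
apply: nl; exists l => x.
have [Wx|nWx] := pselect (span W x).
  by apply: spanB; [apply: uW|apply: spanZ].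
have gen z : ~ span W z -> ~ span (z |` W) x -> span W (u z - l *: z) ->
    span W (u x - l *: x).
  move=> nz nzx hz.
  have nxz : ~ span W (x + z).
    move=> h; apply: nzx; rewrite -[x](addrK z); apply: spanB => //; exact: sWy.
  have [k hk] := key _ nWx; have [k' hk'] := key _ nxz.
  have : span W ((k' - k) *: x + (k' - l) *: z).
    have -> : (k' - k) *: x + (k' - l) *: z =
        (u x - k *: x) + (u z - l *: z) - (u (x + z) - k' *: (x + z)).
      by rewrite (linD ul) scalerDr !scalerBl addrACA [in RHS]addrACA tri.
    by apply: spanB => //; apply: spanD.
  move=> h.
  have kk : k' = k.
    apply/eqP; rewrite -subr_eq0; apply/negPn/negP => n0; apply: nzx.
    rewrite -[x]scale1r -(mulVf n0) -scalerA; apply: spanZ.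
    rewrite -[(k' - k) *: x](addrK ((k' - l) *: z)); apply: spanB; first exact: sWy.
    exact: spanZ.
  move: h; rewrite kk subrr scale0r add0r => h.
  suff -> : l = k by [].
  apply/eqP; rewrite eq_sym -subr_eq0; apply/negPn/negP => n0; apply: nz.
  by rewrite -[z]scale1r -(mulVf n0) -scalerA; apply: spanZ.
have [nyx|yx] := pselect (span (y |` W) x); last exact: (gen y).
apply: (gen y') => // y'x.
have /span_exch[a ha] := y'x.
have [a0|a0] := eqVneq a 0; first by apply: nWx; move: ha; rewrite a0 scale0r subr0.
apply: nWy'; rewrite -[y']scale1r -(mulVf a0) -scalerA; apply: spanZ.
by rewrite -[a *: y'](subKr x); apply: spanB => //; apply: sWy.
Qed.

End Pairs.

(** * Endomorphisms of finite rank *)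

Section FiniteDim.
Variables (F : fieldType) (V : lmodType F).

Lemma lin_mul (c : V -> F^o) (a : F^o) : lin c -> lin (fun x => c x * a : F^o).
Proof. by move=> cl x y z; rewrite cl mulrDl -mulrA. Qed.

(** The coordinates are forms on the whole space, so that the [c i] and [b i] give a projection onto
    the span of [s] and compute traces on it. *)
Lemma finite_coordinates (s : seq V) : exists n (b : nat -> V) (c : nat -> V -> F^o),
  [/\ forall i, lin (c i), forall i, (i < n)%N -> span [set` s] (b i) &
    forall y, span [set` s] y -> y = \sum_(i < n) c i y *: b i].
Proof.
elim: s => [|x s [n [b [c [cl sb sc]]]]].
  exists 0%N, (fun=> 0), (fun _ _ => 0); split=> //; first by move=> i; apply: lin_zero.
  by move=> y; rewrite big_ord0; elim.
have sub y : span [set` s] y -> span [set` x :: s] y.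
  by apply: span_sub => z /= zs; rewrite inE zs orbT.
have [sx|nsx] := pselect (span [set` s] x).
  have xs y : span [set` x :: s] y -> span [set` s] y.
    by apply: span_trans => z /=; rewrite inE => /predU1P[-> //|zs]; apply: span_in.
  exists n, b, c; split=> //=; first by move=> i /sb/sub.
  by move=> y /xs/sc.
have [f [fl fx f0]] := sep_form nsx.
exists n.+1, (fun i => if (i < n)%N then b i else x),
  (fun i => if (i < n)%N then fun y => c i y - f y * c i x else f); split=> //.
- by move=> i; case: ifP => // _; apply: lin_sub => //; apply: lin_mul.
- by move=> i _; case: ifP => [/sb/sub//|_]; apply: span_in => /=; rewrite mem_head.
- move=> y sy; have [a ha] : exists a, span [set` s] (y - a *: x).
    apply: span_exch; apply: span_sub sy => z /=.
    by rewrite inE => /predU1P[->|]; [left|right].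
  have ya : f y = a.
    have := f0 _ ha; rewrite (linB fl) (linZ fl) fx => /eqP.
    by rewrite subr_eq0 => /eqP ->; rewrite /GRing.scale /= mulr1.
  rewrite big_ord_recr /= ltnn -[LHS](subrK (f y *: x)); congr (_ + _).
  rewrite ya {1}(sc _ ha); apply: eq_bigr => i _.
  by rewrite ltn_ord (linB (cl i)) (linZ (cl i)) ?ya.
Qed.

(** Both sides are the double sum of [c i (w k) * phi k (b i)]; this is why the trace does not
    depend on the decomposition. *)
Lemma trace_basis m (w : 'I_m -> V) (phi : 'I_m -> V -> F^o) n (b : nat -> V)
    (c : nat -> V -> F^o) : (forall k, lin (phi k)) -> (forall i, lin (c i)) ->
  (forall k, w k = \sum_(i < n) c i (w k) *: b i) ->
  \sum_(k < m) phi k (w k) = \sum_(i < n) c i (\sum_(k < m) phi k (b i) *: w k).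
Proof.
move=> phil cl wE.
transitivity (\sum_(k < m) \sum_(i < n) c i (w k) * phi k (b i)).
  apply: eq_bigr => k _; rewrite {1}wE (lin_sum (phil k)).
  by apply: eq_bigr => i _; rewrite (linZ (phil k)).
rewrite exchange_big /=; apply: eq_bigr => i _; rewrite (lin_sum (cl i)).
by apply: eq_bigr => k _; rewrite (linZ (cl i)) mulrC.
Qed.

Lemma trace_zero m (w : 'I_m -> V) (phi : 'I_m -> V -> F^o) :
  (forall k, lin (phi k)) -> (forall x, \sum_(k < m) phi k x *: w k = 0) ->
  \sum_(k < m) phi k (w k) = 0.
Proof.
move=> phil phi0.
have [n [b [c [cl _ sc]]]] := finite_coordinates (codom w).
rewrite (trace_basis (n := n) (b := b) phil cl) => [|k].
  by rewrite big1 // => i _; rewrite phi0 (lin0 (cl i)).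
by apply: sc; apply: span_in => /=; apply: codom_f.
Qed.

End FiniteDim.

(** * Chains of cyclic blocks *)

Section Chain.
Variables (F : fieldType) (V : lmodType F).
Hypothesis c2 : forall x : V, x + x = 0.
Variables (u : V -> V) (ul : lin u).
Variables (n : nat) (b : nat -> V) (c : nat -> V -> F^o) (E : pred nat) (d : nat -> F).

Definition dproj x := \sum_(i < n) c i x *: b i.

Let nonend := [set x | exists2 j, (j < n)%N && ~~ E j & b j = x].

Definition biorth := (forall i, lin (c i)) /\
  forall i j, (i < n)%N -> (j < n)%N -> c i (b j) = (i == j)%:R.

(* A sequence of cyclic blocks [x, u x, ..., u^(s-1) x] of size at least 2 (the first
   one may have size 1), laid end to end; [E] marks the last vector of each block. *)
Definition chain := [/\ biorth,
  forall i, (i < n)%N -> ~~ E i -> (i.+1 < n)%N /\ u (b i) = b i.+1,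
  forall i, (i.+1 < n)%N -> E i -> ~~ E i.+1 &
  forall i, (i < n)%N -> E i -> span nonend (u (b i) - d i *: b i)].

(* The diagonal of [N = u - e]: [N b_i = b_(i+1) + h_i b_i] for all [i] but the last one. *)
Let h j := if E j then d j + 1 else 0.

Section Swap.
Hypothesis ch : chain.
Hypothesis hsum : forall i, (i.+1 < n)%N -> E i -> \sum_(j < i.+1) h j != 0.
Hypothesis htot : \sum_(j < n) h j = 0.
Hypothesis n0 : (0 < n)%N.

Let cl i : lin (c i). Proof. by case: ch => -[]. Qed.
Let cb i j : (i < n)%N -> (j < n)%N -> c i (b j) = (i == j)%:R.
Proof. by case: ch => -[_ +] _ _ _; apply. Qed.

(* [b_i = X_i(N) b_0]. *)
Fixpoint X_ i : {poly F} := if i is j.+1 then X_ j * 'X + h j *: X_ j else 1.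

Let X_S i j : (X_ i.+1)`_j.+1 = (X_ i)`_j + h i * (X_ i)`_j.+1.
Proof. by rewrite /= coefD coefMX coefZ. Qed.

Let X_gt i j : (i < j)%N -> (X_ i)`_j = 0.
Proof.
elim: i j => [|i IHi] [|j] // ij; first by rewrite coef1.
by rewrite X_S !IHi ?mulr0 ?addr0 // ltnW.
Qed.

Let X_lead i : (X_ i)`_i = 1.
Proof. by elim: i => [|i IHi]; rewrite ?coef1 // X_S IHi X_gt ?mulr0 ?addr0. Qed.

Let X_sub i : (X_ i.+1)`_i = \sum_(j < i.+1) h j.
Proof.
elim: i => [|i IHi]; first by rewrite /= coefD coefMX coefZ coef1 add0r mulr1 big_ord1.
by rewrite X_S IHi X_lead mulr1 [RHS]big_ord_recr.
Qed.

(* The span of the [X_j] with [j] not an end reaches all the coefficients of the wrong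
   parity: at an end [m], [X_m] is not available, but [X_(m+1)] has the nonzero
   coefficient [h_0 + ... + h_m] in degree [m]. *)
Let adjust m (r : {poly F}) : (m < n)%N -> (forall i, (m <= i)%N -> r`_i = 0) ->
  exists2 l : nat -> F, forall j, ~~ ((j < n)%N && ~~ E j) -> l j = 0 &
    forall i, odd (i + n) -> (r + \sum_(j < n) l j *: X_ j)`_i = 0.
Proof.
elim: m r => [|m IHm] r mn r0.
  exists (fun=> 0) => // i _; rewrite big1 ?addr0 ?r0 // => j _.
  by rewrite scale0r.
have upd k a (l : nat -> F) : (k < n)%N ->
    \sum_(j < n) (l j + (if j == k :> nat then a else 0)) *: X_ j =
    \sum_(j < n) l j *: X_ j + a *: X_ k.
  move=> kn; under eq_bigr do rewrite scalerDl.
  rewrite big_split /=; congr (_ + _).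
  rewrite (bigD1 (Ordinal kn)) //= eqxx big1 ?addr0 // => j jk.
  by rewrite ifN ?scale0r.
have mn' : (m < n)%N by apply: ltnW.
have [odm|odm] := boolP (odd (m + n)); last first.
  have [i im|l l0 hl] := IHm (r - r`_m *: 'X^m) mn'.
    rewrite coefB coefZ coefXn; have [->|ne] := eqVneq i m; first by rewrite mulr1 subrr.
    by rewrite mulr0 subr0 r0 // ltn_neqAle eq_sym ne.
  exists l => // i oi; apply: etrans (hl i oi).
  rewrite !coefD coefN coefZ coefXn; have [im|_] := eqVneq i m; last by rewrite mulr0 subr0.
  by rewrite im (negbTE odm) in oi.
have [Em|nEm] := boolP (E m); last first.
  have [i im|l l0 hl] := IHm (r - r`_m *: X_ m) mn'.
    rewrite coefB coefZ; have [->|ne] := eqVneq i m.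
      by rewrite X_lead mulr1 subrr.
    have mi : (m < i)%N by rewrite ltn_neqAle eq_sym ne.
    by rewrite X_gt // mulr0 subr0 r0.
  exists (fun j => l j + (if j == m then - r`_m else 0)) => [j nj|i oi].
    by rewrite l0 // add0r; case: eqP => // jm; rewrite jm mn' nEm in nj.
  by rewrite upd // scaleNr [_ + (- _)]addrC addrA hl.
have nEm : ~~ E m.+1 by case: ch => _ _ + _; apply.
have sm := hsum mn Em; set sg := \sum_(_ < _) _ in sm.
(* Subtracting [a *: X_ m.+1] kills degree [m]; the leading term it brings in degree [m.+1] has the
   right parity and is discarded. *)
pose a := r`_m / sg.
have [i im|l l0 hl] := IHm (r - a *: X_ m.+1 + a *: 'X^(m.+1)) mn'.
  rewrite coefD coefB !coefZ coefXn; have [->|ne] := eqVneq i m.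
    by rewrite X_sub eqn_leq ltnn andbF mulr0 addr0 /a divfK ?subrr.
  have mi : (m < i)%N by rewrite ltn_neqAle eq_sym ne.
  rewrite r0 // sub0r; have [->|ne'] := eqVneq i m.+1.
    by rewrite X_lead addNr.
  by rewrite X_gt ?mulr0 ?oppr0 ?addr0 // ltn_neqAle eq_sym ne'.
exists (fun j => l j + (if j == m.+1 then - a else 0)) => [j nj|i oi].
  by rewrite l0 // add0r; case: eqP => // jm; rewrite jm mn nEm in nj.
rewrite upd // scaleNr [_ + (- _)]addrC addrA; apply: etrans (hl i oi).
rewrite !coefD !coefN !coefZ coefXn; have [im|_] := eqVneq i m.+1; last by rewrite mulr0 addr0.
by rewrite im /= odm in oi.
Qed.

(** On the chain, [b 0] generates everything under [N], and the polynomial [P = X_n + sum l_j X_j]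
    in [N] kills it. As [P] has only coefficients of the parity of [n], even parts are well defined
    modulo [P]: taking them is the projection [p], and multiplication by ['X] exchanges even and odd
    parts. *)
Lemma idem3_chain : idem3 dproj u.
Proof.
have [[_ _] C1 C2 C4] := ch.
have [m nm] : exists m, n = m.+1 by exists n.-1; rewrite prednK.
(* In degree [m = n - 1], where no correction is available because the last vector is an end, the
   coefficient of [X_ n] is the total of the [h j], zero by [htot]. *)
have [|i|l l0 hl] := @adjust m (X_ n - 'X^n).
- by rewrite nm.
- rewrite coefB coefXn leq_eqVlt => /predU1P[<-|].
    by rewrite nm X_sub -nm htot eqn_leq nm ltnn andbF subr0.
  rewrite -nm leq_eqVlt => /predU1P[<-|ni]; first by rewrite X_lead eqxx subrr.
  by rewrite X_gt // eqn_leq leqNgt ni subr0.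
pose L := \sum_(j < n) l j *: b j.
have span_ne (f : V -> V) : lin f -> (forall j, (j < n)%N -> ~~ E j -> f (b j) = 0) ->
    forall x, span nonend x -> f x = 0.
  move=> fl f0 x; elim=> [|a y z [j /andP[jn Ej] <-] _ IHz]; first exact: lin0.
  by rewrite fl f0 // IHz scaler0 addr0.
have neL : span nonend L.
  apply: span_sum => j _ _; have [jE|/l0 ->] := boolP ((j < n)%N && ~~ E j).
    by apply/spanZ/span_in; exists j.
  by rewrite scale0r; apply: span0.
have Dl : lin dproj by apply: lin_bigsum => i _; apply: lin_form.
have comb (g : nat -> V) : lin (fun x => \sum_(i < n) c i x *: g i).
  by apply: lin_bigsum => i _; apply: lin_form.
have combb (g : nat -> V) j : (j < n)%N -> \sum_(i < n) c i (b j) *: g i = g j.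
  move=> jn; rewrite (bigD1 (Ordinal jn)) //= cb // eqxx scale1r big1 ?addr0 //.
  by move=> i ij; rewrite cb // (negbTE (_ : val i != j)) ?scale0r.
have Db j : (j < n)%N -> dproj (b j) = b j by apply: combb.
have cD i x : (i < n)%N -> c i (dproj x) = c i x.
  move=> jn; rewrite /dproj (lin_sum (cl i)) (bigD1 (Ordinal jn)) //=.
  rewrite (linZ (cl i)) cb // eqxx big1 => [|k ki].
    by rewrite addr0 /GRing.scale /= mulr1.
  by rewrite (linZ (cl i)) cb // eq_sym (negbTE (_ : val k != i)) ?scaler0.
have combD (g : nat -> V) x :
    \sum_(i < n) c i (dproj x) *: g i = \sum_(i < n) c i x *: g i.
  by apply: eq_bigr => i _; rewrite cD.
have DD x : dproj (dproj x) = dproj x by apply: combD.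
have Dne x : span nonend x -> dproj x = x.
  elim=> [|a y z [j /andP[jn Ej] <-] _ IHz]; first exact: lin0.
  by rewrite Dl IHz Db.
pose nx i := if (i.+1 < n)%N then b i.+1 else L.
(* At an end, [e] is the identity up to non-ends, on which it vanishes: hence it is idempotent. The
   correction makes [N (b i)] equal to [nx i] plus [h i *: b i], with the adjustable vector [L] as
   [nx] of the last index. *)
pose ev_ i := if E i then b i + (u (b i) - d i *: b i) - nx i else 0.
pose e x := \sum_(i < n) c i x *: ev_ i.
have el : lin e by apply: comb.
have eb j : (j < n)%N -> e (b j) = ev_ j by apply: combb.
have ene x : span nonend x -> e x = 0.
  by apply: span_ne => // j jn Ej; rewrite eb // /ev_ (negbTE Ej).
have nxne i : E i -> (i < n)%N -> span nonend (nx i).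
  rewrite /nx; case: ifP => // i1 Ei _; apply: span_in; exists i.+1 => //.
  by rewrite i1 C2.
have eev i : (i < n)%N -> e (ev_ i) = ev_ i.
  move=> ni; rewrite {1}/ev_; case: ifP => Ei; last by rewrite (lin0 el) /ev_ Ei.
  by rewrite (linB el) (linD el) eb // !ene ?addr0 ?subr0 //; [apply: nxne|apply: C4].
have Dev i : (i < n)%N -> dproj (ev_ i) = ev_ i.
  move=> ni; rewrite /ev_; case: ifP => Ei; last exact: lin0.
  by rewrite (linB Dl) (linD Dl) Db // !Dne //; [apply: nxne|apply: C4].
have Du i : (i < n)%N -> dproj (u (b i)) = u (b i).
  move=> ni; have [Ei|/(C1 _ ni)[ni1 ->]] := boolP (E i); last exact: Db.
  rewrite -[u (b i)](subrK (d i *: b i)) (linD Dl) (linZ Dl) Db // Dne //.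
  exact: C4.
have combf (f : V -> V) (g : nat -> V) x : lin f -> f (\sum_(i < n) c i x *: g i) =
    \sum_(i < n) c i x *: f (g i).
  by move=> fl; rewrite (lin_sum fl); apply: eq_bigr => i _; rewrite (linZ fl).
pose N x := \sum_(i < n) c i x *: (u (b i) - ev_ i).
have Nl : lin N := comb (fun i => u (b i) - ev_ i).
have Nb j : (j < n)%N -> N (b j) = u (b j) - ev_ j.
  exact: (combb (fun i => u (b i) - ev_ i)).
have DN x : dproj (N x) = N x.
  apply: etrans (combf dproj (fun i => u (b i) - ev_ i) x Dl) _.
  by apply: eq_bigr => i _; rewrite (linB Dl) Du // Dev.
have Nnx i : (i < n)%N -> N (b i) + h i *: b i = nx i.
  move=> ni; rewrite Nb // /ev_ /h; case: ifP => Ei; last first.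
    rewrite scale0r addr0 subr0 /nx.
    by have [-> ->] := C1 _ ni (negbT Ei).
  have -> : u (b i) - (b i + (u (b i) - d i *: b i) - nx i) = nx i + (d i *: b i - b i).
    rewrite opprB addrCA; congr (_ + _).
    by rewrite opprD opprB addrC -addrA subrK addrC.
  by rewrite scalerDl scale1r -addrA addrACA addNr addr0 c2 addr0.
pose y i := iter i N (b 0%N).
pose ev (p : {poly F}) := \sum_(i < n.+2) p`_i *: y i.
have evD (p q : {poly F}) : ev (p + q) = ev p + ev q.
  by rewrite -big_split; apply: eq_bigr => i _; rewrite coefD scalerDl.
have evZ a (p : {poly F}) : ev (a *: p) = a *: ev p.
  by rewrite scaler_sumr; apply: eq_bigr => i _; rewrite coefZ scalerA.
have evX (p : {poly F}) : p`_n.+1 = 0 -> ev (p * 'X) = N (ev p).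
  move=> pn; rewrite /ev big_ord_recl coefMX scale0r add0r.
  rewrite [RHS](lin_sum Nl) [RHS]big_ord_recr /= pn scale0r (lin0 Nl) addr0.
  by apply: eq_bigr => i _; rewrite coefMX /= (linZ Nl).
pose Ev (p : {poly F}) : {poly F} := \poly_(i < n.+2) (if odd i then 0 else p`_i).
have EvE (p : {poly F}) i : (i < n.+2)%N -> (Ev p)`_i = if odd i then 0 else p`_i.
  by rewrite coef_poly => ->.
have evEvD (p q : {poly F}) : ev (Ev (p + q)) = ev (Ev p) + ev (Ev q).
  rewrite -evD; apply: eq_bigr => i _; rewrite coefD !EvE // coefD.
  by case: odd; rewrite ?addr0.
have evEvZ a (p : {poly F}) : ev (Ev (a *: p)) = a *: ev (Ev p).
  rewrite -evZ; apply: eq_bigr => i _; rewrite coefZ !EvE // coefZ.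
  by case: odd; rewrite ?mulr0.
have evEvX (p : {poly F}) : p`_n.+1 = 0 -> ev (Ev (p * 'X)) = N (ev p) - N (ev (Ev p)).
  move=> pn; rewrite -evX // -evX; last by rewrite EvE // pn; case: odd.
  rewrite -[X in _ = _ - X]scale1r -scaleNr -evZ -evD.
  apply: eq_bigr => i _; rewrite EvE // coefD coefZ !coefMX.
  case: i => -[|i] /= ni; first by rewrite mulr0 addr0.
  rewrite EvE; last exact: ltnW.
  by case: odd => /=; rewrite ?mulr0 ?addr0 // mulN1r subrr.
have evXb i : (i < n)%N -> ev (X_ i) = b i.
  elim: i => [|i IHi] ni.
    rewrite /ev big_ord_recl coef1 scale1r big1 ?addr0 // => j _.
    by rewrite coef1 scale0r.
  have ni' := ltnW ni.
  rewrite /= evD evZ evX ?IHi ?Nnx // /nx ?ni // X_gt //.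
  exact: leq_trans (leqnSn n).
have Dev' (p : {poly F}) : dproj (ev p) = ev p.
  rewrite (lin_sum Dl); apply: eq_bigr => i _; rewrite (linZ Dl); congr (_ *: _).
  by case: (val i) => [|k]; [apply: Db|apply: DN].
pose P := X_ n + \sum_(j < n) l j *: X_ j.
have evP : ev P = 0.
  rewrite evD nm /= evD evZ evX; last by rewrite X_gt // nm ltnW.
  rewrite evXb ?nm // Nnx ?nm // /nx nm ltnn.
  rewrite (_ : ev _ = L) ?c2 // (big_morph ev evD (id1 := 0)); last first.
    by rewrite /ev big1 // => i _; rewrite coef0 scale0r.
  by rewrite /L -nm; apply: eq_bigr => j _; rewrite evZ evXb.
have Pbad i : odd (i + n) -> P`_i = 0.
  move=> oi; apply: etrans (hl i oi); rewrite /P !coefD coefN coefXn.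
  have [im|_] := eqVneq i n; last by rewrite subr0.
  by rewrite im addnn odd_double in oi.
have evEvP : ev (Ev P) = 0.
  have [on|on] := boolP (odd n).
    rewrite /ev big1 // => i _; rewrite EvE //; case: ifP => oi; first by rewrite scale0r.
    by rewrite Pbad ?scale0r // oddD oi on.
  rewrite -[RHS]evP; apply: eq_bigr => i _; rewrite EvE //; case: ifP => // oi.
  by rewrite Pbad // oddD oi (negbTE on).
pose p x := \sum_(i < n) c i x *: ev (Ev (X_ i)).
have pl : lin p := comb (fun i => ev (Ev (X_ i))).
have pev (r : {poly F}) : (forall i, (n <= i)%N -> r`_i = 0) -> p (ev r) = ev (Ev r).
  have: (n <= n)%N by [].
  elim: {-2}n r => [|k IHk] r kn r0.
    have -> : r = 0 by apply/polyP => i; rewrite coef0 r0.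
    have e0 : ev 0 = 0 by rewrite /ev big1 // => i _; rewrite coef0 scale0r.
    rewrite e0 (lin0 pl) /ev big1 // => i _.
    by rewrite EvE // coef0 if_same scale0r.
  have -> : r = (r - r`_k *: X_ k) + r`_k *: X_ k by rewrite subrK.
  rewrite evD evEvD evZ evEvZ (linD pl) (linZ pl) IHk 1?ltnW //.
    by rewrite evXb // [p (b k)](combb (fun i => ev (Ev (X_ i)))).
  move=> i ki; rewrite coefB coefZ; have [->|ne] := eqVneq i k.
    by rewrite X_lead mulr1 subrr.
  have lki : (k < i)%N by rewrite ltn_neqAle eq_sym ne.
  by rewrite (r0 i) // X_gt // mulr0 subr0.
have pb j : (j < n)%N -> p (b j) = ev (Ev (X_ j)).
  exact: (combb (fun i => ev (Ev (X_ i)))).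
have pNb i : (i < n)%N -> p (N (b i)) + N (p (b i)) = N (b i).
  move=> ni; rewrite pb //.
  have Xn1 : (X_ i)`_n.+1 = 0 by rewrite X_gt // ltnW // ltnS ltnW.
  have [ni1|] := ltnP i.+1 n.
    rewrite -{1}evXb // -evX // pev ?evEvX ?subrK ?evXb // => -[|k] nk.
      by rewrite coefMX.
    by rewrite coefMX /= X_gt // -ltnS (leq_trans ni1).
  (* At the last vector, [X_ i * 'X] has degree [n], out of reach of [pev]; subtracting [P], also
     monic of degree [n] and killed by [ev], lowers the degree. *)
  move=> ni1; have nm' : n = i.+1 by apply/eqP; rewrite eqn_leq ni1 ni.
  have -> : N (b i) = ev (X_ i * 'X - P).
    by rewrite -[- P]scaleN1r evD evZ evP scaler0 addr0 evX // evXb.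
  rewrite pev => [|k nk]; last first.
    have Pk : P`_k = (X_ n)`_k.
      rewrite coefD coef_sum big1 ?addr0 // => j _.
      by rewrite coefZ X_gt ?mulr0 //; apply: leq_trans nk.
    rewrite coefB {}Pk.
    case: k nk => [|k] nk; first by rewrite nm' in nk.
    rewrite coefMX /=; move: nk; rewrite leq_eqVlt => /predU1P[ek|nk].
      have -> : k = i by move: ek; rewrite nm' => -[->].
      by rewrite X_lead -nm' X_lead subrr.
    by rewrite !X_gt ?subrr // -ltnS (leq_trans _ nk) // ltnS.
  by rewrite -[- P]scaleN1r evEvD evEvZ evEvP evEvX // evD evZ evP !scaler0 !addr0 evX // subrK.
have NDx x : N (dproj x) = N x := combD (fun i => u (b i) - ev_ i) x.
have pN x : p (N x) + N (p x) = N x.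
  have -> : N (p x) = \sum_(i < n) c i x *: N (p (b i)).
    apply: etrans (combf N (fun i => ev (Ev (X_ i))) x Nl) _.
    by apply: eq_bigr => i _; rewrite pb.
  have -> : N x = \sum_(i < n) c i x *: N (b i).
    by apply: eq_bigr => i _; rewrite Nb.
  rewrite (combf p (fun i => N (b i)) x pl) -big_split; apply: eq_bigr => i _.
  by rewrite /= -scalerDr pNb.
apply: (@idem3_swap _ _ c2 dproj u e p N) => // [x|x|x|x|x|x|x].
- apply: etrans (combf dproj ev_ x Dl) _.
  by apply: eq_bigr => i _; rewrite Dev.
- exact: (combD ev_).
- apply: etrans (combf dproj (fun i => ev (Ev (X_ i))) x Dl) _.
  by apply: eq_bigr => i _; rewrite Dev'.
- exact: (combD (fun i => ev (Ev (X_ i)))).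
- apply: etrans (combf e ev_ x el) _.
  by apply: eq_bigr => i _; rewrite eev.
- apply: etrans (combf p (fun i => ev (Ev (X_ i))) x pl) _.
  apply: eq_bigr => i _; rewrite pev.
    congr (_ *: _); apply: eq_bigr => k _; rewrite !EvE //.
    by case: odd.
  move=> k nk; rewrite coef_poly; case: ifP => // _; case: odd => //.
  by rewrite X_gt // (leq_trans _ nk).
- apply: etrans (combf u b x ul) _; rewrite -big_split; apply: eq_bigr => i _ /=.
  by rewrite -scalerDr addrC subrK.
Qed.

End Swap.
End Chain.

(** A unitriangular matrix has a two-sided inverse. In [split_piece], one side gives forms dual to
    the orbit and the other recovers the old forms from them. *)
Lemma dual_family (F : fieldType) m (M : nat -> nat -> F) :
  (forall i j, (j < i < m)%N -> M i j = 0) ->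
  (forall i, (i < m)%N -> M i i = 1) ->
  exists q : nat -> nat -> F, forall i j, (i < m)%N -> (j < m)%N ->
    \sum_(k < m) q i k * M k j = (i == j)%:R /\
    \sum_(k < m) M i k * q k j = (i == j)%:R.
Proof.
case: m => [|m] M0 M1; first by exists (fun _ _ => 0).
pose A : 'M[F]_m.+1 := \matrix_(i, j) M i j.
have uA : A \in unitmx.
  rewrite unitmxE -det_tr det_trig.
    by rewrite big1 ?unitr1 // => i _; rewrite !mxE M1.
  by apply/is_trig_mxP => i j ij; rewrite !mxE M0 // ij ltn_ord.
exists (fun i j => invmx A (inord i) (inord j)) => i j im jm; split.
  have /matrixP/(_ (inord i) (inord j)) := mulVmx uA.
  rewrite !mxE -val_eqE /= !inordK // => <-.
  by apply: eq_bigr => k _; rewrite !mxE inord_val inordK.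
have /matrixP/(_ (inord i) (inord j)) := mulmxV uA.
rewrite !mxE -val_eqE /= !inordK // => <-.
by apply: eq_bigr => k _; rewrite !mxE inord_val inordK.
Qed.

(** * Splitting off a cyclic subspace of maximal dimension *)

Section Piece.
Variables (F : fieldType) (V : lmodType F).
Variables (u : V -> V) (ul : lin u).

Definition orb x j := [set y : V | exists2 i, (i < j)%N & y = iter i u x].

Definition indep m x := forall j, (j < m)%N -> ~ span (orb x j) (iter j u x).

Lemma orb_sub x i j : (i <= j)%N -> orb x i `<=` orb x j.
Proof. by move=> ij y [k ki ->]; exists k => //; apply: leq_trans ij. Qed.

Lemma span_orb_iter x j m : span (orb x j) (iter j u x) -> (j <= m)%N ->
  span (orb x j) (iter m u x).
Proof.
move=> sj /subnK <-; elim: (m - j)%N => // k; rewrite addSn /=.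
elim=> [|a y z [i ij ->] _ IHz]; first by rewrite (lin0 ul); apply: span0.
rewrite ul; apply: span_lin IHz.
move: ij; rewrite leq_eqVlt => /predU1P[ij|ij]; last first.
  by apply: span_in; exists i.+1.
by rewrite -iterS ij.
Qed.

Lemma indep_free m x : indep m x -> free (orb x m) /\
  forall i j, (i < m)%N -> (j < m)%N -> iter i u x = iter j u x -> i = j.
Proof.
move=> ix; split.
  elim: m ix => [|m IHm] ix; first by move=> y [].
  apply: (@free_sub _ _ _ (iter m u x |` orb x m)); last first.
    apply: free_add; last by apply: ix.
    by apply: IHm => j jm; apply: ix; apply: leqW.
  move=> y [i]; rewrite ltnS leq_eqVlt => /predU1P[->|im] ->; first by left.
  by right; exists i.
have aux i j : (i < j)%N -> (j < m)%N -> iter i u x <> iter j u x.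
  by move=> ij jm e; apply: (ix j jm); rewrite -e; apply: span_in; exists i.
move=> i j im jm e; case: (ltngtP i j) => // [ij|ji].
  by case: (aux i j).
by case: (aux j i).
Qed.

(** Only [u x, ..., u^(m-1) x] are known to lie in the span of [s], not [x] itself: hence the
    successor. *)
Lemma indep_bound (s : seq V) m x : indep m x ->
  (forall i, (0 < i)%N -> span [set` s] (iter i u x)) -> (m <= (size s).+1)%N.
Proof.
move=> ix sx; have [fx xi] := indep_free ix.
case: m ix fx xi => // m ix fx xi; rewrite ltnS.
pose A := [set y | exists2 i, (i < m)%N & y = iter i.+1 u x].
have Ax : A `<=` orb x m.+1 by move=> y [i im ->]; exists i.+1.
have /(card_le_embeds _ _ 0) : embeds A [set` s].
  by apply: steinitz (free_sub Ax fx) _ => y [i im ->]; apply: sx.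
have : (`I_m #<= A)%card.
  apply/(card_le_embeds _ _ 0); exists (fun i => iter i.+1 u x); split=> [i im|i j im jm].
    by exists i.
  by move=> e; case: (xi i.+1 j.+1 im jm e).
move=> h1 /(card_le_trans h1).
have : ([set` s] #<= `I_(size s))%card.
  apply/(card_le_embeds _ _ 0%N); exists (index^~ s); split=> [y|y z ys zs].
    by rewrite /= index_mem.
  exact: index_inj.
by move=> h2 /card_le_trans /(_ h2); rewrite card_le_II.
Qed.

Variables (r : V -> V) (rl : lin r).
Hypotheses (rr : forall x, r (r x) = r x) (ru : forall x, r (u x) = u (r x)).

Lemma r_iter x i : r x = x -> r (iter i u x) = iter i u x.
Proof. by move=> rx; elim: i => //= i IHi; rewrite ru IHi. Qed.

(* [m] is the largest dimension of a cyclic subspace, reached at [x]. If a linear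
   form [f] vanishes at [u^i x] for [i < m - 1] and not at [u^(m-1) x], then the
   common kernel of the forms [f \o u^i], [i < m], is a complement of the subspace
   generated by [x], and it is stable under [u] because all cyclic subspaces have
   dimension at most [m]. *)
Lemma split_piece (s : seq V) k :
  (forall x, span [set` s] (u (r x))) -> (exists x, u (r x) <> 0) ->
  r k = k -> u k = 0 -> k <> 0 ->
  exists m x (a : nat -> V -> F^o), let b i := iter i u x in
  [/\ (1 < m)%N, r x = x, biorth m b a,
      (forall i y, a i (r y) = a i y) &
      [/\ dproj m b a (u (b m.-1)) = u (b m.-1) &
      forall y, dproj m b a (u y) = u (dproj m b a y)]].
Proof.
move=> sr [x0 ux0] rk uk k0.
have s0 y : span (@set0 V) y -> y = 0 by elim.
pose Q m := `[< exists2 x, r x = x & indep m x >].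
(* If [r x0] is an eigenvector, its eigenvalue is nonzero, so adding the kernel vector [k] gives a
   vector that is not an eigenvector. *)
have Q2 : Q 2.
  apply/asboolP.
  suff [x rx ux] : exists2 x, r x = x & forall l, u x <> l *: x.
    exists x => // -[_|[_|//]] /= sx.
      apply: (ux 0); rewrite scale0r -[RHS](lin0 ul); congr u; apply: s0.
      by apply: span_sub sx => y [].
    have /span_exch[l /s0 /eqP] : span (x |` set0) (u x).
      by apply: span_sub sx => y [[|//] _ ->]; left.
    by rewrite subr_eq0 => /eqP /ux.
  have [[l ul0]|nl] := pselect (exists l, u (r x0) = l *: r x0); last first.
    by exists (r x0) => // l e; apply: nl; exists l.
  exists (r x0 + k) => [|l']; first by rewrite (linD rl) rr rk.
  rewrite (linD ul) uk addr0 => e.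
  have ll : (l - l') *: u (r x0) = 0.
    have := congr1 u e; rewrite ul0 !(linZ ul) (linD ul) uk addr0 -ul0 => e'.
    by rewrite scalerBl e' subrr.
  have [l0|l0] := eqVneq (l - l') 0.
    apply: k0; have [l00|l00] := eqVneq l 0.
      by case: ux0; rewrite ul0 l00 scale0r.
    have /eqP : l *: k = 0.
      apply: (addrI (l *: r x0)); rewrite addr0 -scalerDr -ul0 e.
      by move/eqP: l0; rewrite subr_eq0 => /eqP ->.
    by rewrite scaler_eq0 (negbTE l00) => /eqP.
  case: ux0; rewrite -[u _]scale1r -(mulVf l0) -scalerA ll scaler0 //.
have Qb m : Q m -> (m <= (size s).+1)%N.
  move=> /asboolP[x rx /indep_bound]; apply=> -[//|i] _.
  by rewrite /= -(r_iter i rx); apply: sr.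
have [m /asboolP[x rx ix] mmax] := ex_maxnP (ex_intro (fun m => Q m) 2%N Q2) Qb.
have m1 : (1 < m)%N by apply: mmax.
have mx z : r z = z -> span (orb z m) (iter m u z).
  move=> rz; apply: contrapT => nz.
  suff /mmax : Q m.+1 by rewrite ltnn.
  apply/asboolP; exists z => // j jm sj; apply: nz.
  by apply: (span_sub (orb_sub (j := m) _) (span_orb_iter sj _)).
pose m0 := m.-1.
have mE : m = m0.+1 by rewrite /m0 prednK // ltnW.
have [f1 [f1l f1x f10]] := @sep_form _ _ (orb x m0) (iter m0 u x) (ix m0 (eq_leq (esym mE))).
have rC i y : r (iter i u y) = iter i u (r y) by elim: i => //= i IHi; rewrite ru IHi.
have itl i : lin (iter i u) by elim: i => // i IHi; apply: (lin_comp ul IHi).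
(* The exponents run backwards to make the matrix of the [f i (b j)] unitriangular, as [f1] vanishes
   on the orbit before [u^m0 x]. *)
pose f i y : F^o := f1 (r (iter (m0 - i) u y)).
have fl i : lin (f i) by apply: (lin_comp f1l (lin_comp rl (itl _))).
pose b i := iter i u x.
have fb i j : (i < m)%N -> f i (b j) = f1 (b (m0 - i + j)%N).
  by move=> im; rewrite /f -iterD rC rx.
have [i j /andP[ji im]|i im|q hq] := @dual_family F m (fun i j => f i (b j)).
- rewrite fb //; apply/f10/span_in; exists (m0 - i + j)%N => //.
  by rewrite -[X in (_ < X)%N](subnK (_ : i <= m0)%N) ?ltn_add2l // -ltnS -mE.
- by rewrite fb // subnK // -ltnS -mE.
pose a i y : F^o := \sum_(k < m) q i k *: f k y.
have al i : lin (a i) by apply: lin_bigsum => l _; apply: lin_scale.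
have ab i j : (i < m)%N -> (j < m)%N -> a i (b j) = (i == j)%:R.
  by move=> im jm; have [<- _] := hq i j im jm.
have fr i y : f i (r y) = f i y by rewrite /f !rC rr.
have fa l y : (l < m)%N -> (forall i, (i < m)%N -> a i y = 0) -> f l y = 0.
  move=> km a0.
  have -> : f l y = \sum_(j < m) (l == j)%:R *: f j y.
    rewrite (bigD1 (Ordinal km)) //= eqxx scale1r big1 ?addr0 // => j jk.
    by rewrite eq_sym (negbTE (_ : val j != l)) ?scale0r.
  have -> : \sum_(j < m) (l == j)%:R *: f j y =
      \sum_(j < m) \sum_(i < m) f l (b i) *: (q i j *: f j y).
    apply: eq_bigr => j _; have [_ <-] := hq l j km (ltn_ord j).
    by rewrite scaler_suml; apply: eq_bigr => i _; rewrite scalerA.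
  rewrite exchange_big big1 // => i _; rewrite -scaler_sumr -/(a i y) a0 //.
  by rewrite scaler0.
have comb j : (j < m)%N -> dproj m b a (b j) = b j.
  move=> jm; rewrite /dproj (bigD1 (Ordinal jm)) //= ab // eqxx scale1r big1 ?addr0 //.
  by move=> i ij; rewrite ab // (negbTE (_ : val i != j)) ?scale0r.
have gl : lin (dproj m b a) by apply: lin_bigsum => i _; apply: lin_form.
have gs z : span (orb x m) z -> dproj m b a z = z.
  by elim=> [|c y w [i im ->] _ IHw]; [apply: lin0|rewrite gl IHw (comb i)].
have gu j : (j < m)%N -> dproj m b a (u (b j)) = u (b j).
  move=> jm; apply: gs; have -> : u (b j) = iter j.+1 u x by [].
  move: jm; rewrite leq_eqVlt => /predU1P[->|jm]; first exact: mx.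
  by apply: span_in; exists j.+1.
exists m, x, a; split=> //.
  by move=> i y; apply: eq_bigr => l _; rewrite fr.
split=> [|y]; first by apply: gu; rewrite mE.
pose g := dproj m b a; pose z := y - g y.
have ag i : (i < m)%N -> a i (g y) = a i y.
  move=> im; rewrite /g /dproj (lin_sum (al i)) (bigD1 (Ordinal im)) //=.
  rewrite (linZ (al i)) ab // eqxx big1 => [|l li].
    by rewrite addr0 /GRing.scale /= mulr1.
  by rewrite (linZ (al i)) ab // eq_sym (negbTE (_ : val l != i)) ?scaler0.
have az i : (i < m)%N -> a i z = 0 by move=> im; rewrite (linB (al i)) ag // subrr.
have fz k' : (k' < m)%N -> f k' z = 0 by move=> km; apply: fa.
have guz : g (u z) = 0.
  rewrite /g /dproj big1 // => i _.
  suff -> : a i (u z) = 0 by rewrite scale0r.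
  rewrite /a big1 // => -[k' km] _ /=; suff -> : f k' (u z) = 0 by rewrite scaler0.
  (* [f k'.+1] at [u z] is [f k'] at [z]. For [f 0], maximality of [m] writes [u^m (r z)] through
     the lower iterates of [r z]. *)
  rewrite /f -iterSr; case: k' km => [|k'] km; last first.
    have km0 : (k' < m0)%N by rewrite -ltnS -mE.
    by rewrite subnSK //; exact: (fz k' (ltnW km)).
  rewrite subn0 -mE rC; elim: (mx (r z) (rr z)) => [|c v w [l lm ->] _ IHw].
    exact: lin0.
  rewrite f1l IHw addr0 -rC.
  have lE : l = (m0 - (m0 - l))%N by rewrite subKn // -ltnS -mE.
  have lm' : (m0 - l < m)%N by rewrite mE ltnS leq_subr.
  by have := fz _ lm'; rewrite /f -lE => ->; rewrite scaler0.
rewrite -[y in u y](subrK (g y)) -/z (linD ul) (linD gl) -/g guz add0r.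
rewrite /g {2 3}/dproj (lin_sum ul) (lin_sum gl); apply: eq_bigr => i _.
by rewrite (linZ ul) (linZ gl) gu.
Qed.

End Piece.

Section Idem3Sum.
Variables (F : fieldType) (V : lmodType F).
Implicit Types (d u : V -> V).

Lemma idem3_ext d d' u : (forall x, d x = d' x) -> idem3 d u -> idem3 d' u.
Proof. by move=> /funext <-. Qed.

Lemma idem3_zero d u : lin d -> (forall x, u (d x) = 0) -> idem3 d u.
Proof.
move=> dl ud; exists (fun=> 0), (fun=> 0), (fun=> 0); split=> [x|e].
  by rewrite ud !addr0.
move=> eE; have -> : e = (fun=> 0) by case: eE => [->|[->|->]].
by split=> //; [apply: lin_zero|move=> x; apply: lin0].
Qed.

Lemma idem3_add d1 d2 u : lin u -> lin d1 -> lin d2 ->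
  (forall x, d1 (d2 x) = 0) -> (forall x, d2 (d1 x) = 0) ->
  idem3 d1 u -> idem3 d2 u -> idem3 (fun x => d1 x + d2 x) u.
Proof.
move=> ul l1 l2 d12 d21 [e1 [e2 [e3 [uE eP]]]] [f1 [f2 [f3 [uF fP]]]].
have key e f : e = e1 \/ e = e2 \/ e = e3 -> f = f1 \/ f = f2 \/ f = f3 ->
    [/\ lin (fun x => e x + f x),
        forall x, e (e x + f x) + f (e x + f x) = e x + f x,
        forall x, d1 (e x + f x) + d2 (e x + f x) = e x + f x &
        forall x, e (d1 x + d2 x) + f (d1 x + d2 x) = e x + f x].
  move=> /eP[el ee de ed] /fP[fl ff df fd].
  have d1f x : d1 (f x) = 0 by rewrite -df d12.
  have d2e x : d2 (e x) = 0 by rewrite -de d21.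
  have ef x : e (f x) = 0 by rewrite -ed d1f (lin0 el).
  have fe x : f (e x) = 0 by rewrite -fd d2e (lin0 fl).
  split=> [|x|x|x].
  - exact: lin_add.
  - by rewrite (linD el) (linD fl) ee ff ef fe addr0 add0r.
  - by rewrite (linD l1) (linD l2) de df d1f d2e addr0 add0r.
  - rewrite (linD el) (linD fl) ed fd.
    by rewrite -(ed (d2 x)) d12 -(fd (d1 x)) d21 (lin0 el) (lin0 fl) addr0 add0r.
exists (fun x => e1 x + f1 x), (fun x => e2 x + f2 x), (fun x => e3 x + f3 x).
split=> [x|e]; last first.
  by case=> [->|[->|->]]; apply: key; auto.
by rewrite (linD ul) uE uF addrACA; congr (_ + _); rewrite addrACA.
Qed.

End Idem3Sum.

(** * Rank descent and kernel vectors *)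

Section Rank.
Variables (F : fieldType) (V : lmodType F).

Lemma drop_span (g : V -> V) (s : seq V) v : lin g -> span [set` s] v ->
  v <> 0 -> g v = 0 -> exists2 s' : seq V, (size s' < size s)%N &
    forall y, span [set` s] y -> span [set` s'] (g y).
Proof.
move=> gl; elim: s v => [|x s IHs] v; first by elim.
move=> sv v0 gv.
have exch y : span [set` x :: s] y -> exists a, span [set` s] (y - a *: x).
  move=> sy; apply: span_exch; apply: span_sub sy => z /=.
  by rewrite inE => /predU1P[->|]; [left|right].
have [a ha] := exch _ sv.
have [a0|a0] := eqVneq a 0.
  have sv' : span [set` s] v by move: ha; rewrite a0 scale0r subr0.
  have [s' ss' hs'] := IHs v sv' v0 gv.
  exists (g x :: s') => // y sy; have [b hb] := exch _ sy.
  rewrite -[y](subrK (b *: x)) (linD gl) (linZ gl); apply: spanD.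
    by apply: span_sub (hs' _ hb) => z /= zs; rewrite inE zs orbT.
  by apply/spanZ/span_in => /=; rewrite mem_head.
have gs y : span [set` s] y -> span [set` map g s] (g y).
  elim=> [|b z w zs _ IHw]; first by rewrite (lin0 gl); apply: span0.
  by rewrite gl; apply: spanP => //=; apply: map_f.
have gx : span [set` map g s] (g x).
  rewrite -[g x]scale1r -(mulVf a0) -scalerA; apply: spanZ.
  have -> : a *: g x = - g (v - a *: x) by rewrite (linB gl) (linZ gl) gv sub0r opprK.
  exact/spanN/gs.
exists (map g s) => [|y sy]; first by rewrite size_map.
have [b hb] := exch _ sy.
rewrite -[y](subrK (b *: x)) (linD gl) (linZ gl).
by apply: spanD; [apply: gs|apply: spanZ].
Qed.

Lemma forms_span (P : V -> Prop) N (f : nat -> V -> F^o) :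
  (forall a x y, P x -> P y -> P (a *: x + y)) -> (forall i, lin (f i)) ->
  exists t : seq V, forall y, P y ->
    exists2 z, span [set` t] z & P (y - z) /\ forall i, (i < N)%N -> f i (y - z) = 0.
Proof.
move=> Plin fl; elim: N => [|N [t ht]].
  exists [::] => y Py; exists 0; first exact: span0.
  by rewrite subr0; split.
have [[x [Px fx fNx]]|nx] := pselect (exists x,
    [/\ P x, forall i, (i < N)%N -> f i x = 0 & f N x <> 0]); last first.
  exists t => y Py; have [z tz [Pz fz]] := ht y Py.
  exists z => //; split=> // i; rewrite ltnS leq_eqVlt => /predU1P[->|/fz//].
  by apply: contrapT => fN; apply: nx; exists (y - z).
have sub z : span [set` t] z -> span [set` x :: t] z.
  by apply: span_sub => w /= wt; rewrite inE wt orbT.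
exists (x :: t) => y Py; have [z tz [Pz fz]] := ht y Py.
pose a := f N (y - z) / f N x.
have e : y - (z + a *: x) = (- a) *: x + (y - z).
  by rewrite opprD addrA addrC scaleNr.
exists (z + a *: x).
  by apply: spanD; [apply: sub|apply/spanZ/span_in => /=; rewrite mem_head].
split=> [|i]; first by rewrite e; apply: Plin.
rewrite ltnS leq_eqVlt e fl => /predU1P[->|iN]; last by rewrite fx // fz // scaler0 addr0.
rewrite scaleNr /a /GRing.scale /= divfK ?addNr //; exact/eqP.
Qed.

Definition infinite_range (r : V -> V) :=
  forall t : seq V, exists x, ~ span [set` t] (r x).

Definition comm_proj (u r : V -> V) :=
  [/\ lin r, forall x, r (r x) = r x & forall x, r (u x) = u (r x)].

(** Among [n + n] forms, half detect that [u z = 0] and half that a vector of the span of [s] is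
    zero. If all kernel vectors in the range of [r] were in that span, the forms would have no
    common zero there but 0, making that range finite-dimensional. *)
Lemma kernel_vector (u r : V -> V) (s : seq V) : lin u -> comm_proj u r ->
  infinite_range r -> (forall x, span [set` s] (u x)) ->
  exists k (c : V -> F^o), [/\ r k = k, u k = 0, lin c, c k = 1 &
    (forall y, c (u y) = 0) /\ forall y, c (r y) = c y].
Proof.
move=> ul [rl rr ru] rinf su.
have [k [rk uk nk]] : exists k, [/\ r k = k, u k = 0 & ~ span [set` s] k].
  apply: contrapT => nk.
  have [n [b [c [cl _ sc]]]] := finite_coordinates s.
  have [|i|t ht] := @forms_span (fun y => r y = y) (n + n)
      (fun i => if (i < n)%N then fun y => c i (u y) else c (i - n)%N).
  - by move=> a x y rx ry; rewrite rl rx ry.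
  - by case: ifP => // _; apply: (lin_comp (cl i) ul).
  have [x nx] := rinf t; apply: nx.
  have [z tz [rz fz]] := ht (r x) (rr x).
  have uz : u (r x - z) = 0.
    rewrite (sc _ (su _)) big1 // => i _.
    have lt2 : (i < n + n)%N := leq_trans (ltn_ord i) (leq_addr _ _).
    by have := fz i lt2; rewrite ltn_ord => ->; rewrite scale0r.
  have sz : span [set` s] (r x - z).
    by apply: contrapT => nz; apply: nk; exists (r x - z).
  suff e : r x - z = 0 by rewrite -[r x](subrK z) e add0r.
  rewrite (sc _ sz) big1 // => i _.
  have lt2 : (n + i < n + n)%N by rewrite ltn_add2l.
  by have := fz _ lt2; rewrite ltnNge leq_addr /= addKn => ->; rewrite scale0r.
have [c [cl ck c0]] := sep_form nk.
exists k, (c \o r); split=> //=; first exact: lin_comp.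
  by rewrite rk.
by split=> y; [rewrite ru c0|rewrite rr].
Qed.

End Rank.

(** * Extending and closing a chain *)

Section FiniteRank.
Variables (F : fieldType) (V : lmodType F).
Hypothesis c2 : forall x : V, x + x = 0.
Hypothesis c2F : forall a : F, a + a = 0.
Variables (u : V -> V) (ul : lin u).

Definition in_F2 (a : F) := a = 0 \/ a = 1.

Lemma in_F2D a b : in_F2 a -> in_F2 b -> in_F2 (a + b).
Proof.
by move=> [->|->] [->|->]; rewrite ?addr0 ?add0r ?c2F; [left|right|right|left].
Qed.

Lemma in_F2_sum (I : Type) (r : seq I) (P : pred I) (f : I -> F) :
  (forall i, P i -> in_F2 (f i)) -> in_F2 (\sum_(i <- r | P i) f i).
Proof. by move=> h; elim/big_ind: _ => //; [left|apply: in_F2D]. Qed.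

Lemma in_F2_cancel a b : in_F2 b -> in_F2 (a + b) -> in_F2 a.
Proof. by move=> h1 /in_F2D /(_ h1); rewrite -addrA c2F addr0. Qed.

Definition cat_family (T : Type) n (f g : nat -> T) i := if (i < n)%N then f i else g (i - n)%N.

Definition end_sum (E : pred nat) (d : nat -> F) n := \sum_(j < n | E j) d j.

Section Append.
Variables (n : nat) (b : nat -> V) (c : nat -> V -> F^o) (E : pred nat) (d : nat -> F).
Variables (m : nat) (x : V) (a : nat -> V -> F^o).
Let b' i := iter i u x.
(** On a cyclic block only the last diagonal entry can be nonzero, so this is the trace of [u] on
    the block. *)
Let dl := a m.-1 (u (b' m.-1)).
Hypotheses (ch : chain u n b c E d) (m1 : (1 < m)%N) (ba : biorth m b' a)
  (ub : dproj m b' a (u (b' m.-1)) = u (b' m.-1))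
  (cb : forall i j, (i < n)%N -> (j < m)%N -> c i (b' j) = 0)
  (ab : forall i j, (i < m)%N -> (j < n)%N -> a i (b j) = 0).

Definition app_ends (E : pred nat) i := ((i < n) && E i || (i == (n + m).-1))%N.
Let E' := app_ends E.
Definition app_diag := cat_family n d (fun=> dl).

Let m0 : (0 < m)%N. Proof. exact: ltnW. Qed.
Let last_ge : (n <= (n + m).-1)%N.
Proof. by case: m m0 => // k _; rewrite addnS leq_addr. Qed.

Let E'lt i : (i < n)%N -> E' i = E i.
Proof.
move=> ni; rewrite /E' /app_ends ni /= (ltn_eqF (leq_trans ni last_ge)) orbF //.
Qed.

Let E'ge i : (n <= i)%N -> E' i = (i == (n + m).-1).
Proof. by move=> ni; rewrite /E' /app_ends ltnNge ni. Qed.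

Lemma append_chain : chain u (n + m) (cat_family n b b') (cat_family n c a) E' app_diag.
Proof.
have [[cl cb1] C1 C2 C4] := ch; have [al ab1] := ba.
have sub i : (n <= i)%N -> (i < n + m)%N -> (i - n < m)%N.
  by move=> ni im; rewrite -(ltn_add2l n) subnKC.
split.
- split=> [i|i j ni nj]; first by rewrite /cat_family; case: ifP.
  rewrite /cat_family; case: ltnP => il; case: ltnP => jl.
  + exact: cb1.
  + by rewrite cb ?(ltn_eqF (leq_trans il jl)) //; apply: sub.
  + by rewrite ab ?(gtn_eqF (leq_trans jl il)) //; apply: sub.
  + by rewrite ab1 ?sub // eqn_sub2rE.
- move=> i im nE; have [il|il] := ltnP i n.
    rewrite E'lt // in nE; have [i1 uE] := C1 _ il nE.
    by rewrite (leq_trans i1 (leq_addr _ _)) /cat_family il i1.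
  rewrite E'ge // in nE.
  have i1 : (i.+1 < n + m)%N.
    rewrite ltn_neqAle im andbT; apply: contra nE => /eqP <-; exact: eqxx.
  by split=> //; rewrite /cat_family !ltnNge il (leqW il) /= subSn.
- move=> i im Ei; have [il|il] := ltnP i n; last first.
    by rewrite E'ge // in Ei; move: im; rewrite -ltn_predRL -(eqP Ei) ltnn.
  rewrite E'lt // in Ei.
  have [i1|i1] := ltnP i.+1 n; first by rewrite E'lt // C2.
  have -> : i.+1 = n by apply/eqP; rewrite eqn_leq il i1.
  rewrite E'ge // neq_ltn; apply/orP; left.
  by case: m m1 => [|[|k]] // _; rewrite !addnS /= ltnS leq_addr.
- move=> i im Ei; have [il|il] := ltnP i n.
    rewrite E'lt // in Ei; rewrite /app_diag /cat_family il.
    apply: span_sub (C4 _ il Ei) => y [j /andP[jn nEj] <-].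
    exists j; last by rewrite jn.
    by rewrite E'lt // nEj (leq_trans jn (leq_addr _ _)).
  rewrite E'ge // in Ei; have iE : i = (n + m.-1)%N.
    by rewrite (eqP Ei); case: m m0 => // k _; rewrite addnS.
  rewrite /app_diag /cat_family iE ltnNge leq_addr /= addKn -{1}ub /dproj.
  have recr (g : nat -> V) : \sum_(i < m) g i = \sum_(i < m.-1) g i + g m.-1.
    by case: m m0 => // k _; rewrite big_ord_recr.
  rewrite (recr (fun i => a i (u (b' m.-1)) *: b' i)) addrK.
  apply: span_sum => j _ _; apply/spanZ/span_in; exists (n + j)%N.
    have jm := ltn_ord j; rewrite E'ge ?leq_addr // ltn_add2l.
    rewrite (leq_trans jm (leq_pred m)) /=.
    by case: m m0 j jm => // k _ j jm; rewrite addnS eqn_add2l (ltn_eqF jm).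
  by rewrite ltnNge leq_addr /= addKn.
Qed.

Lemma append_end_sum i : (i <= n)%N -> end_sum E' app_diag i = end_sum E d i.
Proof.
move=> ni; apply: eq_big => [j|j _]; first by rewrite E'lt // (leq_trans _ ni).
by rewrite /app_diag /cat_family (leq_trans _ ni).
Qed.

Lemma append_total : end_sum E' app_diag (n + m) = end_sum E d n + dl.
Proof.
rewrite /end_sum big_split_ord /=; congr (_ + _); first exact: append_end_sum.
have k0 : (m.-1 < m)%N by rewrite prednK.
rewrite (big_pred1 (Ordinal k0)) => [|j] /=.
  by rewrite /app_diag /cat_family ltnNge leq_addr.
rewrite E'ge ?leq_addr // -val_eqE /=.
by case: m m0 j {k0} => // k _ j; rewrite addnS eqn_add2l.
Qed.

Lemma append_dproj y : dproj (n + m) (cat_family n b b') (cat_family n c a) y =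
  dproj n b c y + dproj m b' a y.
Proof.
rewrite /dproj big_split_ord /=; congr (_ + _); apply: eq_bigr => i _.
  by rewrite /cat_family ltn_ord.
by rewrite /cat_family ltnNge leq_addr /= addKn.
Qed.

End Append.

(* The vector [k] repairs the parity: if the diagonal of [N] sums up to 1 along the
   chain, then [k] is added as a first block of size 1, which contributes 1. *)
Lemma close_chain n b c E d k (ck : V -> F^o) : chain u n b c E d ->
  (0 < n)%N -> ~~ E 0%N ->
  (forall i, (i.+1 < n)%N -> E i -> ~ in_F2 (end_sum E d i.+1)) ->
  in_F2 (end_sum E d n) -> u k = 0 -> lin ck -> ck k = 1 ->
  (forall i, (i < n)%N -> ck (b i) = 0) -> (forall i, (i < n)%N -> c i k = 0) ->
  idem3 (fun x => ck x *: k + dproj n b c x) u.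
Proof.
move=> ch n0 nE0 op tot uk cl ck1 ckb ckk.
have [[cil cb] C1 C2 C4] := ch.
pose h j : F := if E j then d j + 1 else 0.
(* The number of ends counts as 0 or 1 in [F], so partial sums outside {0, 1} remain outside: they
   are the pivots required by [idem3_chain]. *)
have hE i : \sum_(j < i) h j = end_sum E d i + \sum_(j < i | E j) 1.
  by rewrite -big_mkcond -big_split.
have ones i : in_F2 (\sum_(j < i | E j) 1) by apply: in_F2_sum => j _; right.
have kl : lin (fun x => ck x *: k) by apply: lin_form.
have Dl : lin (dproj n b c) by apply: lin_bigsum => i _; apply: lin_form.
have [tot0|tot1] : in_F2 (\sum_(j < n) h j) by rewrite hE; apply: in_F2D.
  apply: idem3_add => //.
  - move=> x; rewrite (lin_sum cl) big1 ?scale0r // => i _.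
    by rewrite (linZ cl) ckb ?scaler0.
  - move=> x; rewrite /dproj big1 // => i _.
    by rewrite (linZ (cil i)) ckk // scaler0 scale0r.
  - by apply: idem3_zero => // x; rewrite (linZ ul) uk scaler0.
  - apply: (idem3_chain c2 ul ch) => // i i1 Ei.
    apply/eqP; rewrite hE => e; apply: (op _ i1 Ei).
    by apply: (in_F2_cancel (ones i.+1)); rewrite e; left.
pose b1 i := if i is j.+1 then b j else k.
pose c1 i := if i is j.+1 then c j else ck.
pose E1 i := if i is j.+1 then E j else true.
pose d1 i := if i is j.+1 then d j else 0.
have ch1 : chain u n.+1 b1 c1 E1 d1.
  split.
  - split=> [[|i]|[|i] [|j]] //=; rewrite !ltnS => ni nj //.
    + exact: ckb.
    + exact: ckk.
    + exact: cb.
  - by move=> [|i] //=; rewrite !ltnS => ni /(C1 _ ni).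
  - by move=> [|i] //=; rewrite !ltnS => ni /(C2 _ ni).
  - move=> [|i] /=; first by rewrite uk scale0r subrr => _ _; apply: span0.
    rewrite ltnS => ni Ei; apply: span_sub (C4 _ ni Ei) => y [j jn <-].
    by exists j.+1.
apply: (idem3_ext (d := dproj n.+1 b1 c1)) => [x|].
  by rewrite /dproj big_ord_recl.
apply: (idem3_chain c2 ul ch1) => // [[|i]|].
- by rewrite big_ord1 /= add0r oner_neq0.
- rewrite ltnS /= => i1 Ei; apply/eqP; rewrite big_ord_recl /= add0r.
  rewrite -/(\sum_(j < i.+1) h j) hE => e; apply: (op _ i1 Ei).
  apply: (in_F2_cancel (ones i.+1)); apply: (in_F2_cancel (b := 1)); first by right.
  by rewrite addrC e; left.
- by rewrite big_ord_recl /= add0r [X in 1 + X]tot1 c2F.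
Qed.

End FiniteRank.

(** * Induction on the rank *)

Section FiniteRankMain.
Variables (F : fieldType) (V : lmodType F).
Hypothesis c2 : forall x : V, x + x = 0.
Hypothesis c2F : forall a : F, a + a = 0.
Variables (u : V -> V) (ul : lin u).
Variables (N0 : nat) (w : 'I_N0 -> V) (phi : 'I_N0 -> V -> F^o).
Hypotheses (phil : forall i, lin (phi i))
  (uE : forall x, u x = \sum_(i < N0) phi i x *: w i).

Let tr (r : V -> V) : F := \sum_(i < N0) phi i (r (w i)).

Let su x : span [set` codom w] (u x).
Proof.
rewrite uE; apply: span_sum => i _ _; apply/spanZ/span_in => /=; exact: codom_f.
Qed.

Definition small N (r : V -> V) := exists2 s : seq V, (size s <= N)%N &
  forall x, span [set` s] (u (r x)).

(* [r] projects onto what remains to be treated, and [n b c E d] is the chain under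
   construction, with [k] in reserve. *)
Let rec N := forall (r : V -> V) n b c E d k (ck : V -> F^o),
  comm_proj u r -> small N r -> infinite_range r ->
  chain u n b c E d -> ~~ ((0 < n)%N && E 0%N) ->
  (forall i, (i < n)%N -> E i -> ~ in_F2 (end_sum E d i.+1)) ->
  (forall i, (i < n)%N -> r (b i) = 0) ->
  (forall i y, (i < n)%N -> c i (r y) = 0) ->
  r k = 0 -> u k = 0 -> lin ck -> ck k = 1 -> (forall y, ck (u y) = 0) ->
  (forall y, ck (r y) = 0) ->
  (forall i, (i < n)%N -> ck (b i) = 0) -> (forall i, (i < n)%N -> c i k = 0) ->
  in_F2 (end_sum E d n + tr r) ->
  idem3 (fun x => r x + (ck x *: k + dproj n b c x)) u.

(** Opens an empty chain after splitting a reserve vector [k] off the range of [r]; the trace is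
    unchanged because [ck] vanishes on the range of [u]. *)
Let close_rec N r : rec N -> comm_proj u r -> small N r -> infinite_range r ->
  in_F2 (tr r) -> idem3 r u.
Proof.
move=> recN cr smr rinf trr; have [rl rr ru] := cr.
have [k [ck [rk uk cl ck1 [cu crr]]]] := kernel_vector ul cr rinf su.
pose r' x := r x - ck x *: k.
have kl : lin (fun x => ck x *: k) by apply: lin_form.
have r'l : lin r' by apply: lin_sub.
have ckr' y : ck (r' y) = 0.
  by rewrite (linB cl) crr (linZ cl) ck1 /GRing.scale /= mulr1 subrr.
have r'k : r' k = 0 by rewrite /r' ck1 scale1r rk subrr.
have ur' x : u (r' x) = u (r x) by rewrite (linB ul) (linZ ul) uk scaler0 subr0.
have cr' : comm_proj u r'.
  split=> // x; first by rewrite {1}/r' ckr' scale0r subr0 (linB rl) (linZ rl) rr rk.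
  by rewrite /r' ru cu scale0r subr0 -/(r' x) ur'.
apply: (idem3_ext (d := fun x => r' x + (ck x *: k +
    dproj 0 (fun=> 0) (fun _ _ => 0) x))) => [x|].
  by rewrite /dproj big_ord0 addr0 subrK.
apply: (recN r' 0%N (fun=> 0) _ pred0 (fun=> 0) k ck cr') => //.
- by have [s ss hs] := smr; exists s => // x; rewrite ur'.
- move=> t; have [x hx] := rinf (k :: t); exists x => tx; apply: hx.
  rewrite -[r x](subrK (ck x *: k)); apply: spanD.
    by apply: span_sub tx => y /= ty; rewrite inE ty orbT.
  by apply/spanZ/span_in => /=; rewrite mem_head.
- by split=> //; split=> // i; apply: lin_zero.
- suff -> : end_sum pred0 (fun=> 0) 0 + tr r' = tr r by [].
  rewrite /end_sum big_ord0 add0r /tr.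
  transitivity (\sum_(i < N0) (phi i (r (w i)) - ck (w i) * phi i k)).
    by apply: eq_bigr => i _; rewrite (linB (phil i)) (linZ (phil i)).
  rewrite sumrB -[RHS]subr0; congr (_ - _).
  rewrite -[RHS](cu k) uE (lin_sum cl); apply: eq_bigr => i _.
  by rewrite (linZ cl) mulrC.
Qed.

Let recP N : rec N.
Proof.
elim: N => [|N IHN] r n b c E d k ck cr smr rinf ch nE0 op rb cir rk uk cl ck1 cu ckr ckb cik tot.
all: have [rl rr ru] := cr; have [[cil cb] C1 C2 C4] := ch.
all: have kl : lin (fun x => ck x *: k) by apply: lin_form.
all: have Dl : lin (dproj n b c) by apply: lin_bigsum => i _; apply: lin_form.
(* The remaining trace is then 0; the last vector of a nonempty chain would be an end with partial
   trace in {0, 1}, against [op]. So the chain is empty. *)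
all: have base : (forall x, u (r x) = 0) ->
    idem3 (fun x => r x + (ck x *: k + dproj n b c x)) u.
1,3: move=> ur0; have tr0 : tr r = 0.
1,3: apply: trace_zero => // x; rewrite -[RHS](ur0 x) -ru uE (lin_sum rl);
  by apply: eq_bigr => i _; rewrite (linZ rl).
1,2: have [n0|n0] := posnP n.
1,3: apply: idem3_zero => [|x]; [by do 2?apply: lin_add|];
  by rewrite (linD ul) ur0 (linD ul) (linZ ul) uk scaler0 /dproj n0 big_ord0 (lin0 ul) !addr0.
1,2: have nn : (n.-1 < n)%N by rewrite prednK.
1,2: have En : E n.-1 by apply/negPn/negP => /(C1 _ nn)[]; rewrite prednK // ltnn.
1,2: by case: (op _ nn En); rewrite prednK //; move: tot; rewrite tr0 addr0.
  apply: base => x; have [s] := smr; rewrite leqn0 => /nilP-> /(_ x).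
  by elim.
have [ur0|nur0] := pselect (forall x, u (r x) = 0); first exact: base.
have {base nur0} ux0 : exists x, u (r x) <> 0.
  by apply: contrapT => h; apply: nur0 => x; apply: contrapT => hx; apply: h; exists x.
have [s ss su'] := smr.
have [k' [c' [rk' uk' cl' ck1' _]]] := kernel_vector ul cr rinf su.
have k'0 : k' <> 0.
  by move=> k0; move/eqP: ck1'; rewrite k0 (lin0 cl') eq_sym oner_eq0.
have [m [x [a [m1 rx ba ar [ub gu]]]]] := split_piece ul rl rr ru su' ux0 rk' uk' k'0.
set b' := (fun i => iter i u x) in ba ub gu.
have [al ab] := ba.
have m0 : (0 < m)%N by apply: ltnW.
pose g := dproj m b' a.
have gl : lin g by apply: lin_bigsum => i _; apply: lin_form.
have gu' y : g (u y) = u (g y) := gu y.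
have rb' i : r (b' i) = b' i by apply: r_iter.
have rg y : r (g y) = g y.
  by rewrite (lin_sum rl); apply: eq_bigr => i _; rewrite (linZ rl) rb'.
have gr y : g (r y) = g y by apply: eq_bigr => i _; rewrite ar.
have gb' j : (j < m)%N -> g (b' j) = b' j.
  move=> jm; rewrite /g /dproj (bigD1 (Ordinal jm)) //= ab // eqxx scale1r big1 ?addr0 //.
  by move=> i ij; rewrite ab // (negbTE (_ : val i != j)) ?scale0r.
have gg y : g (g y) = g y.
  rewrite {2}/g /dproj (lin_sum gl); apply: eq_bigr => i _.
  by rewrite (linZ gl) gb'.
have ag i y : (i < m)%N -> a i (g y) = a i y.
  move=> im; rewrite /g /dproj (lin_sum (al i)) (bigD1 (Ordinal im)) //=.
  rewrite (linZ (al i)) ab // eqxx big1 => [|l li].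
    by rewrite addr0 /GRing.scale /= mulr1.
  by rewrite (linZ (al i)) ab // eq_sym (negbTE (_ : val l != i)) ?scaler0.
pose r' y := r y - g y.
have r'l : lin r' by apply: lin_sub.
have cr' : comm_proj u r'.
  split=> // y; first by rewrite /r' (linB rl) (linB gl) rr rg gr gg subrr subr0.
  by rewrite /r' (linB ul) ru gu'.
have r'r y : r' (r y) = r' y by rewrite /r' rr gr.
(* The rank drops because [r'] kills [u x], a nonzero vector of the range of [u \o r]. *)
have sm' : small N r'.
  have b1 : b' 1%N = u (r x) by rewrite rx.
  have [||//|s' ss' hs'] := @drop_span _ _ r' s (b' 1%N) r'l.
  - by rewrite b1.
  - move=> b10; move/eqP: (ab 1%N 1%N m1 m1); rewrite b10 (lin0 (al _)) eqxx.
    by rewrite eq_sym oner_eq0.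
  - by rewrite /r' rb' gb' // subrr.
  exists s'; first by rewrite -ltnS (leq_trans ss').
  move=> y; have [_ _ <-] := cr'; rewrite -r'r ru; exact: hs'.
have rinf' : infinite_range r'.
  move=> t; have [y hy] := rinf (t ++ [seq b' i | i <- iota 0 m]).
  exists y => ty; apply: hy; rewrite -[r y](subrK (g y)); apply: spanD.
    by apply: span_sub ty => z /= zt; rewrite mem_cat zt.
  apply: span_sum => i _ _; apply/spanZ/span_in => /=.
  by rewrite mem_cat map_f ?orbT // mem_iota add0n leq0n ltn_ord.
have trg : tr g = a m.-1 (u (b' m.-1)).
  transitivity (\sum_(i < m) a i (u (b' i))).
    transitivity (\sum_(l < N0) \sum_(i < m) a i (w l) * phi l (b' i)).
      apply: eq_bigr => l _; rewrite (lin_sum (phil l)).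
      by apply: eq_bigr => i _; rewrite (linZ (phil l)).
    rewrite exchange_big; apply: eq_bigr => i _; rewrite uE (lin_sum (al i)).
    by apply: eq_bigr => l _; rewrite (linZ (al i)) mulrC.
  have mm : (m.-1 < m)%N by rewrite prednK.
  rewrite (bigD1 (Ordinal mm)) //= big1 ?addr0 // => i; rewrite -val_eqE /= => im.
  have i1 : (i.+1 < m)%N.
    by rewrite -ltn_predRL ltn_neqAle im -ltnS prednK ?ltn_ord.
  by rewrite -[u (b' i)]/(b' i.+1) ab // (ltn_eqF (ltnSn i)).
have tr' : tr r = tr r' + a m.-1 (u (b' m.-1)).
  rewrite -trg -big_split; apply: eq_bigr => i _.
  by rewrite /= -(linD (phil i)) subrK.
have cb'0 i j : (i < n)%N -> (j < m)%N -> c i (b' j) = 0.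
  by move=> ni _; rewrite -rb' cir.
have a'b i j : (i < m)%N -> (j < n)%N -> a i (b j) = 0.
  by move=> _ nj; rewrite -ar rb // (lin0 (al i)).
have ch' := append_chain ch m1 ba ub cb'0 a'b.
have tot' := append_total u n E d x a m1.
have es' := @append_end_sum _ _ u n E d m x a m1.
have dp' := append_dproj u n b c m x a.
set B := cat_family n b _ in ch' dp'; set C := cat_family n c a in ch' dp'.
set E' := app_ends n m E in ch' tot' es'; set d' := app_diag u n d m x a in ch' tot' es'.
have sub i : (n <= i)%N -> (i < n + m)%N -> (i - n < m)%N.
  by move=> ni im; rewrite -(ltn_add2l n) subnKC.
have nE0' : ~~ E' 0%N.
  rewrite /E' /app_ends negb_or nE0 /=.
  by case: (m) m1 => [|[|l]] // _; rewrite !addnS.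
have op' i : (i.+1 < n + m)%N -> E' i -> ~ in_F2 (end_sum E' d' i.+1).
  move=> im; rewrite /E' /app_ends; case: ltnP => [il /=|_ /= /eqP iE]; last first.
    by move: im; rewrite -ltn_predRL -iE ltnn.
  case/orP => [Ei|/eqP iE]; first by rewrite es' //; apply: op.
  by move: im; rewrite -ltn_predRL -iE ltnn.
have gb i : (i < n)%N -> g (b i) = 0.
  by move=> ni; rewrite /g /dproj big1 // => l _; rewrite a'b ?scale0r.
have gk : g k = 0.
  by rewrite /g /dproj big1 // => l _; rewrite -ar rk (lin0 (al l)) scale0r.
have ckg y : ck (g y) = 0 by rewrite -rg ckr.
have ckB i : (i < n + m)%N -> ck (B i) = 0.
  move=> im; rewrite /B /cat_family; case: ltnP => ni; first exact: ckb.
  by rewrite -/(b' (i - n)%N) -rb' ckr.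
have Cl i : lin (C i) by rewrite /C /cat_family; case: ifP.
have Ck i : (i < n + m)%N -> C i k = 0.
  move=> im; rewrite /C /cat_family; case: ltnP => ni; first exact: cik.
  by rewrite -ar rk (lin0 (al _)).
have r'B i : (i < n + m)%N -> r' (B i) = 0.
  move=> im; rewrite /r' /B /cat_family; case: ltnP => ni.
    by rewrite rb // gb // subrr.
  by rewrite -/(b' (i - n)%N) rb' gb' ?subrr //; apply: sub.
have Cr' i y : (i < n + m)%N -> C i (r' y) = 0.
  move=> im; rewrite (linB (Cl i)) /C /cat_family; case: ltnP => ni.
    by rewrite cir // -rg cir // subrr.
  by rewrite ar ag ?subrr //; apply: sub.
have r'k : r' k = 0 by rewrite /r' rk gk subrr.
have ckr' y : ck (r' y) = 0 by rewrite (linB cl) ckr ckg subrr.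
apply: (idem3_ext (d := fun y => r' y + (ck y *: k + dproj (n + m) B C y))) => [y|].
  transitivity (r y - g y + (g y + (ck y *: k + dproj n b c y))).
    by congr (_ + _); rewrite dp' addrA addrC.
  by rewrite addrA subrK.
(* Outside {0, 1}, the chain stays open and the induction continues with it. Otherwise it is closed
   with [k], the rest has trace in {0, 1}, and a new chain starts with a new reserve vector. *)
have [S1|nS1] := pselect (in_F2 (end_sum E' d' (n + m))); last first.
  apply: (IHN r' (n + m)%N B C E' d' k ck) => //; first by rewrite negb_and nE0' orbT.
    move=> i im Ei; have [i1|i1] := ltnP i.+1 (n + m); first exact: op'.
    by have -> : i.+1 = (n + m)%N by apply/eqP; rewrite eqn_leq im i1.
  by rewrite tot' -addrA [_ + tr r']addrC -tr'.
have kdl : lin (fun y => ck y *: k + dproj (n + m) B C y).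
  by apply: lin_add => //; apply: lin_bigsum => i _; apply: lin_form.
apply: idem3_add => // [y|y||].
- rewrite (linD r'l) (linZ r'l) r'k scaler0 add0r /dproj (lin_sum r'l) big1 // => i _.
  by rewrite (linZ r'l) r'B ?scaler0.
- by rewrite ckr' scale0r add0r /dproj big1 // => i _; rewrite Cr' ?scale0r.
- apply: (close_rec IHN) => //; apply: (in_F2_cancel c2F S1).
  by rewrite tot' addrCA -tr'.
- apply: (close_chain c2 c2F ul ch') => //.
  by rewrite addn_gt0 m0 orbT.
Qed.

Lemma idem3_finite_rank : infinite_range (@id V) -> in_F2 (\sum_(i < N0) phi i (w i)) ->
  idem3 id u.
Proof.
move=> Vinf tru.
have smu : small (size (codom w)) id by exists (codom w).
by apply: (@close_rec _ id (@recP _) _ smu Vinf tru).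
Qed.

End FiniteRankMain.

(** * Comparison with the definitions of the statement *)

Section Conversions.
Variables (F : fieldType) (V : lmodType F).
Implicit Types (A B C S : set V).

Lemma in_span_seqE (s : seq V) x : in_span_seq s x <-> span [set` s] x.
Proof.
split=> [[c ->]|].
  by apply: span_sum => i _ _; apply/spanZ/span_in; apply: mem_nth.
elim=> [|a y z ys _ [c ->]].
  by exists (fun=> 0); rewrite big1 // => i _; rewrite scale0r.
have iy : (index y s < size s)%N by rewrite index_mem.
exists (fun i => c i + (if i == Ordinal iy then a else 0)).
under [RHS]eq_bigr => i _ do rewrite /= scalerDl.
rewrite big_split /= addrC; congr (_ + _).
rewrite (bigD1 (Ordinal iy)) //= eqxx nth_index // big1 ?addr0 // => i /negbTE->.
by rewrite scale0r.
Qed.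

Lemma span_setE B x : span_set B x <-> span B x.
Proof.
split=> [[s [sB /in_span_seqE]]|/span_fin[s sB sx]].
  by apply: span_sub => y /sB; rewrite inE.
by exists s; split; [move=> y /sB; rewrite inE|apply/in_span_seqE].
Qed.

Lemma free_setE B : free_set B <-> free B.
Proof.
split=> [fB x Bx /span_fin[s sB sx]|fB s us sB c cs0 i].
  have /in_span_seqE[c xE] : span [set` undup s] x.
    by apply: span_sub sx => y /=; rewrite mem_undup.
  have xs : x \notin undup s.
    by rewrite mem_undup; apply/negP => /sB[_]; apply.
  pose c' (i : 'I_(size (x :: undup s))) : F := if unlift ord0 i is Some j then c j else - 1.
  have := fB (x :: undup s) _ _ c' _ ord0.
  rewrite /c' unlift_none => h; suff /eqP : - 1 = 0 :> F by rewrite oppr_eq0 oner_eq0.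
  apply: h; first by rewrite /= xs undup_uniq.
    by move=> y; rewrite inE mem_undup => /predU1P[->|/sB[By _]]; rewrite inE.
  rewrite big_ord_recl unlift_none scaleN1r /=; apply/eqP.
  rewrite addrC subr_eq0 [X in _ == X]xE; apply/eqP; apply: eq_bigr => j _.
  by rewrite liftK.
apply/eqP/negPn/negP => ci0; apply: (fB s`_i); first by have /sB := mem_nth 0 (ltn_ord i); rewrite inE.
have e : s`_i = - (c i)^-1 *: \sum_(j < size s | j != i) c j *: s`_j.
  have := cs0; rewrite (bigD1 i) //= => /eqP; rewrite addr_eq0 => /eqP e.
  by rewrite scaleNr -scalerN -e scalerA mulVf ?scale1r.
rewrite [X in span _ X]e; apply/spanZ/span_sum => j _ ji; apply/spanZ/span_in; split.
  by have /sB := mem_nth 0 (ltn_ord j); rewrite inE.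
move=> /= /eqP; rewrite (nth_uniq 0 (ltn_ord j) (ltn_ord i) us) => ji'.
by case/negP: ji.
Qed.

Lemma basis_of_setP S B : basis_of_set S B <->
  [/\ B `<=` S, free B & forall x, S x -> span B x].
Proof.
by split=> [[BS [/free_setE fB SB]]|[BS fB SB]]; split=> //;
  [move=> x /SB/span_setE|split; [apply/free_setE|move=> x /SB/span_setE]].
Qed.

Lemma ex_basis S : exists B, basis_of_set S B.
Proof.
have [B [BS fB _ SB]] := extend_free S (@free_set0 _ V).
by exists B; apply/basis_of_setP; rewrite set0U in fB SB; split.
Qed.

Lemma embeds_setU (T U : choiceType) (A1 A2 : set T) (B : set U) : infinite_set B ->
  embeds A1 B -> embeds A2 B -> embeds (A1 `|` A2) B.
Proof.
move=> Binf [f [fB fi]] [g [gB gi]]; have [t [tB ti]] := infinite_mul_nat Binf.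
pose h x := if pselect (A1 x) then t (f x) 0%N else t (g x) 1%N.
have A2P x : (A1 `|` A2) x -> ~ A1 x -> A2 x by case.
exists h; split=> [x Ax|x y Ax Ay]; rewrite /h.
  by case: pselect => [A1x|nA1x]; apply: tB; [apply: fB|apply/gB/A2P].
case: pselect => [A1x|nA1x]; case: pselect => [A1y|nA1y].
- by move=> /(ti _ _ _ _ (fB _ A1x) (fB _ A1y))[e _]; apply: fi.
- by move=> /(ti _ _ _ _ (fB _ A1x) (gB _ (A2P _ Ay nA1y)))[].
- by move=> /(ti _ _ _ _ (gB _ (A2P _ Ax nA1x)) (fB _ A1y))[].
- move=> /(ti _ _ _ _ (gB _ (A2P _ Ax nA1x)) (gB _ (A2P _ Ay nA1y)))[e _].
  by apply: gi => //; apply: A2P.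
Qed.

Lemma embeds_image (f : V -> V) A : embeds (f @` A) A.
Proof. exact/(card_le_embeds _ _ 0)/card_image_le. Qed.

Lemma not_finite_span A : infinite_range (@id V) -> (forall x, span A x) -> infinite_set A.
Proof. by move=> Vinf sA /finite_seqP[s As]; have [x] := Vinf s; rewrite -As. Qed.

Lemma span_img (f : V -> V) A x : lin f -> span A x -> span (f @` A) (f x).
Proof.
move=> fl; elim=> [|a y z Ay _ IHz]; first by rewrite (lin0 fl); apply: span0.
by rewrite fl; apply: spanP => //; exists y.
Qed.

End Conversions.

(** * Size of a maximal set of pairs *)

Section InfiniteRank.
Variables (F : fieldType) (V : lmodType F).
Hypothesis c2 : forall x : V, x + x = 0.
Variables (u : V -> V) (ul : lin u).
Hypothesis Vinf : infinite_range (@id V).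

Let sh l := fun x => u x - l *: x.

Lemma idem3_infinite_rank :
  (forall l, ~ rank_lt_dim (sh l)) \/
  (rank_lt_dim (sh 0) /\ ~ finite_rank u) -> idem3 id u.
Proof.
move=> hyp; have [S [Sp SW]] := max_pairs ul.
have [ui uS fS] := Sp; set W := S `|` u @` S in SW fS.
have [B /basis_of_setP[Bu fB uB]] := ex_basis (range u).
have [C /basis_of_setP[_ fC sC]] := ex_basis (@setT V).
have /choice[f fP] : forall b, exists x, B b -> u x = b.
  by move=> b; have [/Bu[x _ ux]|nB] := pselect (B b); [exists x|exists 0].
have WS : infinite_set S -> embeds W S.
  by move=> Sinf; apply: embeds_setU => //; [apply: embeds_sub|apply: embeds_image].
have Wfin : ~ infinite_set S -> exists s : seq V, W = [set` s].
  move=> /contrapT Sfin; apply/finite_seqP; rewrite finite_setU; split=> //.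
  exact: finite_image.
(* Preimages of a basis of the range span the space together with the kernel: they form the [X] of
   [idem3_pairs]. *)
suff [Sinf BS] : infinite_set S /\ embeds B S.
  apply: (idem3_pairs c2 ul Sp Sinf (X := f @` B)).
    exact: embeds_trans (embeds_image f B) BS.
  move=> x; have [z zX uz] : exists2 z, span (f @` B) z & u z = u x.
    have uBx : span B (u x) by apply: uB; exists x.
    elim: uBx => [|a b y Bb _ [z zX uz]].
      by exists 0; [apply: span0|rewrite (lin0 ul)].
    exists (a *: f b + z); first by apply: spanP => //; exists b.
    by rewrite ul fP // uz.
  rewrite -[x](subrK z); apply: spanD.
    by apply: span_in; right; rewrite /= (linB ul) uz subrr.
  by apply: span_sub zX => y; left.
case: SW => [[l uW]|[y sW]]; last first.
  have Sinf : infinite_set S.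
    apply: contrapT => /Wfin[s Ws]; apply: (not_finite_span Vinf sW).
    by rewrite finite_setU; split; [apply: finite_set1|rewrite Ws].
  split=> //; apply: (@embeds_trans _ _ _ _ (y |` W)); first exact: steinitz.
  apply: embeds_setU => //; last exact: WS.
  have [s0 Ss0] := infinite_setN0 Sinf.
  by exists (fun=> s0); split=> // x z -> ->.
(* If [l] is not dominant, the range of [u - l id] has full dimension and lies in the span of
   [W]. *)
have [ndl|/contrapT dl] := pselect (~ rank_lt_dim (sh l)).
  have [B' hB'] := ex_basis (range (sh l)).
  have /basis_of_setP[B'u fB' _] := hB'.
  have CB' : embeds C B'.
    apply/(card_le_embeds _ _ 0); apply: contrapT => nCB'.
    by apply: ndl; exists B', C; split=> //; split=> //; apply/basis_of_setP; split.
  have CW : embeds C W.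
    apply: embeds_trans CB' _; apply: steinitz => // x /B'u[z _ <-]; exact: uW.
  have Sinf : infinite_set S.
    apply: contrapT => /Wfin[s Ws]; apply: (not_finite_span Vinf (fun x => sC x I)).
    apply: (finite_embeds 0 CW); rewrite Ws; exact: finite_seq.
  split=> //; apply: embeds_trans (WS Sinf); apply: embeds_trans CW.
  by apply: steinitz => // x _; apply: sC.
case: hyp => [/(_ l)//|[[B0 [C0 [/basis_of_setP[B0u fB0 uB0] [/basis_of_setP[_ fC0 sC0] nCB]]]] nfr]].
have uB0' x : span B0 (u x).
  by apply: uB0; exists x => //; rewrite /sh scale0r subr0.
have [l0|l0] := eqVneq l 0.
  have uW' x : span W (u x) by have := uW x; rewrite l0 scale0r subr0.
  have Sinf : infinite_set S.
    apply: contrapT => /Wfin[s Ws]; apply: nfr; exists s => x.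
    by apply/in_span_seqE; rewrite -Ws.
  split=> //; apply: embeds_trans (WS Sinf).
  by apply: steinitz => // x /Bu[z _ <-].
(* Since [l x = u x - (u x - l x)], the space is spanned by [B0] and [W]; as [u] is injective on [S]
   and [u(S)] is free, [W] is no larger than the rank, against the dominance of 0. *)
exfalso; apply: nCB; apply/(card_le_embeds _ _ 0).
have B0inf : infinite_set B0.
  move=> /finite_seqP[s Bs]; apply: nfr; exists s => x.
  by apply/in_span_seqE; rewrite -Bs.
apply: (@embeds_trans _ _ _ _ (B0 `|` W)).
  apply: steinitz => // x _; rewrite -[x]scale1r -(mulVf l0) -scalerA; apply: spanZ.
  rewrite -[l *: x](subKr (u x)); apply: spanB.
    by apply: span_sub (uB0' x) => z; left.
  by apply: span_sub (uW x) => z; right.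
have uSB : embeds (u @` S) B0.
  apply: steinitz => [|x [s _ <-]//]; by apply: free_sub fS => x; right.
apply: embeds_setU => //; first exact: embeds_sub.
apply: embeds_setU => //; apply: embeds_trans uSB; exists u; split=> // x Sx; by exists x.
Qed.

End InfiniteRank.

(** Reflection for characteristic 2: once its terms are numbered, an identity is checked by counting
    that each occurs an even number of times. *)
Lemma char2_sum (V : zmodType) (f : nat -> V) (s : seq nat) :
  (forall x : V, x + x = 0) -> all (fun i => ~~ odd (count_mem i s)) s ->
  \sum_(i <- s) f i = 0.
Proof.
move=> c2 /allP sP; rewrite -big_undup_iterop_count big_seq big1 // => i.
rewrite mem_undup => /sP; set n := count_mem i s => nE.
rewrite -[LHS]/(f i *+ n) -(odd_double_half n) (negbTE nE) add0n -mul2n.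
by rewrite mulrnA mulr2n c2 mul0rn.
Qed.

(** * Necessity *)

Section ThreeIdempotents.
Variables (F : fieldType) (V : lmodType F).
Hypothesis c2 : forall x : V, x + x = 0.
Variables (p q r w : V -> V) (l : F).
Hypotheses (pl : lin p) (ql : lin q) (rl : lin r) (wl : lin w).
Hypotheses (pp : forall x, p (p x) = p x) (qq : forall x, q (q x) = q x)
  (rr : forall x, r (r x) = r x) (pqr : forall x, p x + q x + r x = l *: x + w x).

Let om x := w (w x) + (w x + (w (p x) + (p (w x) + (w (q x) + q (w x))))).

Let eq2 (x y : V) : x + y = 0 -> x = y.
Proof. by move=> e; apply/eqP; rewrite -subr_eq0 (char2_opp c2) e. Qed.

Let rE y : r y = l *: y + (w y + (p y + q y)).
Proof.
by rewrite addrA -pqr addrAC c2 add0r.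
Qed.

(* Expand [r (r x) = r x] with [r = l + w + p + q]. *)
Lemma anticomm x : p (q x) + q (p x) = (l * l + l) *: x + om x.
Proof.
have := rr x; rewrite [r (r x)]rE rE.
rewrite !(linD wl) !(linD pl) !(linD ql) !scalerDr (linZ wl) (linZ pl) (linZ ql) pp qq.
move=> e; apply: eq2; rewrite scalerDl -scalerA /om.
(* The index list runs through the terms of [e], then those of the goal. *)
have := @char2_sum V (nth 0 [:: l *: (l *: x); l *: w x; l *: p x; l *: q x; w (w x);
    w (p x); w (q x); p (w x); p x; p (q x); q (w x); q (p x); q x; l *: x; w x])
  [:: 0; 1; 2; 3; 1; 4; 5; 6; 2; 7; 8; 9; 3; 10; 11; 12; 13; 14; 8; 12;
      9; 11; 0; 13; 4; 14; 5; 7; 6; 10] c2 isT.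
rewrite !big_cons big_nil addr0 /= => sum0.
move/(congr1 (fun z => z + (l *: x + (w x + (p x + q x))))): e; rewrite c2 => e.
by apply: etrans sum0; rewrite -[LHS]add0r -e -!addrA.
Qed.

Let s x := p (q x) + q (p x).

Let s_comm x : p (s x) + s (p x) = s x.
Proof.
rewrite /s (linD pl) !pp -addrA; congr (_ + _).
by rewrite addrA c2 add0r.
Qed.

(* For [s = p q + q p], [p s + s p = s] whereas the scalar part of [s] cancels out in
   [p s + s p]. *)
Lemma scalar_om x : (l * l + l) *: x = om x + (p (om x) + om (p x)).
Proof.
have := s_comm x; rewrite {1 2 3}/s !anticomm (linD pl) (linZ pl) addrACA c2 add0r.
move=> e; apply: (addIr (om x)); rewrite -e [RHS]addrAC c2 add0r //.
Qed.

Lemma om_in (A : set V) x :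
  (forall y, span A (w y)) -> (forall y, span A (p (w y))) ->
  (forall y, span A (q (w y))) -> span A (om x).
Proof. by move=> Aw Ap Aq; do !apply: spanD. Qed.

Lemma p_om_in (A : set V) x :
  (forall y, span A (p (w y))) -> (forall y, span A (p (q (w y)))) ->
  span A (p (om x)).
Proof.
by move=> Ap Apq; rewrite !(linD pl) pp; do !apply: spanD.
Qed.

End ThreeIdempotents.

(** * Traces of idempotents in characteristic 2 *)

Section Traces.
Variable (F : fieldType).
Hypothesis c2F : forall a : F, a + a = 0.

(** For [x i j = P_ij P_ji], it turns the trace of [P^2] into the sum of the squared diagonal
    entries. *)
Lemma sum_sym_char2 n (x : nat -> nat -> F) : (forall i j, x i j = x j i) ->
  \sum_(i < n) \sum_(j < n) x i j = \sum_(i < n) x i i.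
Proof.
move=> xs; elim: n => [|n IHn]; first by rewrite !big_ord0.
rewrite [LHS]big_ord_recr [RHS]big_ord_recr /= -IHn.
under eq_bigr do rewrite big_ord_recr.
rewrite big_split /= -addrA; congr (_ + _); rewrite big_ord_recr /= addrA.
have -> : \sum_(j < n) x n j = \sum_(j < n) x j n by apply: eq_bigr => j _.
by rewrite c2F add0r.
Qed.

Lemma sum_sqr_char2 n (x : nat -> F) :
  (\sum_(i < n) x i) ^+ 2 = \sum_(i < n) x i ^+ 2.
Proof.
elim: n => [|n IHn]; first by rewrite !big_ord0 expr0n.
by rewrite !big_ord_recr /= sqrrD IHn mulr2n c2F addr0.
Qed.

Lemma trace_idem (V : lmodType F) (T : set V) n (b : nat -> V) (c : nat -> V -> F^o)
    (p : V -> V) : lin p -> (forall i, lin (c i)) ->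
  (forall x, p (p x) = p x) ->
  (forall i, (i < n)%N -> span T (p (b i))) ->
  (forall y, span T y -> y = \sum_(i < n) c i y *: b i) ->
  in_F2 (\sum_(i < n) c i (p (b i))).
Proof.
move=> pl cl pp Tp cT; set t := \sum_(_ < _) _.
have tt : t ^+ 2 = t.
  rewrite {1}/t (sum_sqr_char2 n (fun i => c i (p (b i)))).
  rewrite -(@sum_sym_char2 n (fun i k => c k (p (b i)) * c i (p (b k)))); last first.
    by move=> i j; rewrite mulrC.
  apply: eq_bigr => i _; rewrite -[in RHS]pp [p (b i) in RHS](cT _ (Tp i (ltn_ord i))).
  rewrite (lin_sum pl) (lin_sum (cl i)); apply: eq_bigr => k _.
  by rewrite (linZ pl) (linZ (cl i)).
have /eqP : t * (t - 1) = 0 by rewrite mulrBr mulr1 -expr2 tt subrr.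
by rewrite mulf_eq0 subr_eq0 => /orP[/eqP|/eqP]; [left|right].
Qed.

End Traces.

Section Necessity.
Variables (F : fieldType) (V : lmodType F).
Hypothesis c2 : forall x : V, x + x = 0.
Hypothesis c2F : forall a : F, a + a = 0.
Variables (p q r w : V -> V) (l : F).
Hypotheses (pl : lin p) (ql : lin q) (rl : lin r) (wl : lin w).
Hypotheses (pp : forall x, p (p x) = p x) (qq : forall x, q (q x) = q x)
  (rr : forall x, r (r x) = r x) (pqr : forall x, p x + q x + r x = l *: x + w x).

Lemma dominant_in_F2 : infinite_range (@id V) -> rank_lt_dim w -> in_F2 l.
Proof.
move=> Vinf [B [C [/basis_of_setP[Bw fB wB] [/basis_of_setP[_ fC sC] nCB]]]].
have [l0|l0] := eqVneq (l * l + l) 0.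
  have /eqP : l * (l + 1) = 0 by rewrite mulrDr mulr1.
  rewrite mulf_eq0 addr_eq0 => /orP[/eqP|/eqP ->]; [by left|right].
  by apply: (addrI 1); rewrite subrr c2F.
exfalso; apply: nCB; apply/(card_le_embeds _ _ 0).
(* [om] takes its values in the sum of the ranges of [w], [p w] and [q w]; composing with [p] adds
   only that of [p q w], so four images of [B] suffice. *)
pose A := B `|` (p @` B `|` (q @` B `|` p @` (q @` B))).
have wB' x : span B (w x) by apply: wB; exists x.
have Aw x : span A (w x) by apply: span_sub (wB' x) => y; left.
have Apw x : span A (p (w x)).
  by apply: span_sub (span_img pl (wB' x)) => y; right; left.
have Aqw x : span A (q (w x)).
  by apply: span_sub (span_img ql (wB' x)) => y; right; right; left.
have Apqw x : span A (p (q (w x))).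
  by apply: span_sub (span_img pl (span_img ql (wB' x))) => y; right; right; right.
have sA x : span A x.
  rewrite -[x]scale1r -(mulVf l0) -scalerA; apply: spanZ.
  rewrite (scalar_om c2 pl ql wl pp qq rr pqr).
  apply: spanD; first exact: om_in.
  by apply: spanD; [exact: (@p_om_in _ _ p q w)|apply: om_in].
have Binf : infinite_set B.
  move=> Bfin; apply: (not_finite_span Vinf sA); rewrite /A !finite_setU.
  by do !split=> //; do ?apply: finite_image.
apply: (@embeds_trans _ _ _ _ A); first by apply: steinitz.
apply: embeds_setU => //; first exact: embeds_sub.
apply: embeds_setU => //; first exact: embeds_image.
apply: embeds_setU => //; first exact: embeds_image.
exact: embeds_trans (embeds_image _ _) (embeds_image _ _).
Qed.

Lemma trace_in_F2 t : l = 0 -> is_trace w t -> in_F2 t.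
Proof.
move=> l0 [m [v [phi [wE ->]]]].
(* Its span is stable under [p] by idempotence, and under [q] because for [l = 0] the map
   [p q + q p = om] takes its values there; [r = w + p + q] follows. *)
pose s := codom v ++ map p (codom v) ++ map q (codom v) ++ map p (map q (codom v)).
pose A := [set` s].
have [n [b [c [cl sb sc]]]] := finite_coordinates s.
have phil k : lin (phi k : V -> F^o) by apply: lin_linear.
have Ain x : x \in s -> span A x by move=> xs; apply: span_in.
have in1 k : span A (v k) by apply: Ain; rewrite mem_cat codom_f.
have in2 k : span A (p (v k)).
  by apply: Ain; rewrite !mem_cat map_f ?codom_f ?orbT.
have in3 k : span A (q (v k)).
  by apply: Ain; rewrite !mem_cat (map_f q) ?codom_f ?orbT.
have in4 k : span A (p (q (v k))).
  by apply: Ain; rewrite !mem_cat (map_f p (map_f q (codom_f v k))) !orbT.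
have wsum (f : V -> V) x : lin f -> (forall k, span A (f (v k))) -> span A (f (w x)).
  by move=> fl fv; rewrite wE (lin_sum fl); apply: span_sum => k _ _;
    rewrite (linZ fl); apply: spanZ.
have Aw x : span A (w x) by apply: (wsum id).
have Apw x : span A (p (w x)) by apply: wsum.
have Aqw x : span A (q (w x)) by apply: wsum.
have qpE x : q (p x) = p (q x) + (p (q x) + q (p x)) by rewrite addrA c2 add0r.
have Aqp x : span A (p (q x)) -> span A (q (p x)).
  move=> h; rewrite qpE; apply: spanD => //.
  rewrite (anticomm c2 pl ql wl pp qq rr pqr) l0 mul0r addr0 scale0r add0r.
  exact: om_in.
have gen (f : V -> V) : lin f -> (forall k, [/\ span A (f (v k)), span A (f (p (v k))),
    span A (f (q (v k))) & span A (f (p (q (v k))))]) ->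
    forall y, span A y -> span A (f y).
  move=> fl fv y; elim=> [|a z y' sz _ IH]; first by rewrite (lin0 fl); apply: span0.
  rewrite fl; apply: span_lin IH; move: sz; rewrite /A /= !mem_cat.
  case/or4P => [/codomP[k ->]|/mapP[_ /codomP[k ->] ->]|/mapP[_ /codomP[k ->] ->]|].
  - by case: (fv k).
  - by case: (fv k).
  - by case: (fv k).
  - by move=> /mapP[_ /mapP[_ /codomP[k ->] ->] ->]; case: (fv k).
have Ap y : span A y -> span A (p y).
  by apply: gen => // k; split; rewrite ?pp.
have Aq y : span A y -> span A (q y).
  apply: gen => // k; split; rewrite ?qq //; first exact: Aqp.
  by apply: Aqp; rewrite qq.
have rE y : r y = (w y + p y) + q y.
  rewrite -[r y]add0r -(c2 (p y + q y)) -addrA pqr l0 scale0r add0r addrC.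
  by rewrite addrA.
have Ar y : span A y -> span A (r y).
  by move=> sy; rewrite rE; apply: spanD; [apply: spanD; [|apply: Ap]|apply: Aq].
have /= e := @trace_basis _ _ m v (fun k => phi k) n b c phil cl (fun k => sc _ (in1 k)).
rewrite [X in in_F2 X]e.
have -> : \sum_(i < n) c i (\sum_(k < m) phi k (b i) *: v k) =
    \sum_(i < n) c i (p (b i)) + \sum_(i < n) c i (q (b i)) + \sum_(i < n) c i (r (b i)).
  rewrite -!big_split; apply: eq_bigr => i _ /=.
  by rewrite -wE -!(linD (cl i)) pqr l0 scale0r add0r.
have tI (f : V -> V) : lin f -> (forall x, f (f x) = f x) ->
    (forall y, span A y -> span A (f y)) -> in_F2 (\sum_(i < n) c i (f (b i))).
  move=> fl ff fA; apply: (@trace_idem F c2F V A n b c f) => // i ni.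
  exact/fA/sb.
by apply: (in_F2D c2F); [apply: (in_F2D c2F)|]; [apply: (tI p)|apply: (tI q)|apply: (tI r)].
Qed.

End Necessity.

Theorem theorem6 (F : fieldType) (V : lmodType F) (u : {linear V -> V}) :
  2 \in [pchar F] ->
  infinite_dim V ->
  (sum_of_three_idempotents u <->
   ~ ((exists l : F, dominant_eigenvalue u l /\ l != 0 /\ l != 1)
      \/
      (exists l : F, (l == 0 \/ l == 1) /\
         finite_rank (fun x => u x - l *: x) /\
         exists t : F, is_trace (fun x => u x - l *: x) t /\ t != 0 /\ t != 1))).
Proof.
move=> ch2 Vinf'.
have c2F (a : F) : a + a = 0 by apply: addrr_pchar2.
have c2 (x : V) : x + x = 0 by rewrite -[x]scale1r -scalerDl c2F scale0r.
have Vinf : infinite_range (@id V).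
  move=> t; apply: contrapT => h; apply: Vinf'; exists t => x.
  by apply/in_span_seqE; apply: contrapT => nx; apply: h; exists x.
have ul : lin u by apply: lin_linear.
have shl l : lin (fun x => u x - l *: x) by apply: lin_sub => //; apply: lin_scale.
split.
  move=> [e1 [e2 [e3 [i1 i2 i3 uE]]]].
  have l1 := lin_linear e1; have l2 := lin_linear e2; have l3 := lin_linear e3.
  move=> [[l [dom [l0 l1']]]|[l [l01 [_ [t [tr [t0 t1]]]]]]].
    suff [e|e] : in_F2 l; [by rewrite e eqxx in l0|by rewrite e eqxx in l1'|].
    apply: (dominant_in_F2 c2 c2F l1 l2 (shl l) i1 i2 i3 _ Vinf dom) => x.
    by rewrite -uE addrC subrK.
  suff [e|e] : in_F2 t; [by rewrite e eqxx in t0|by rewrite e eqxx in t1|].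
  case: l01 => /eqP le; rewrite {l}le in tr.
    apply: (trace_in_F2 c2 c2F l1 l2 l3 (shl 0) i1 i2 i3 _ erefl tr).
    by move=> x; rewrite -uE scale0r subr0 add0r.
  (* As [id - e1 = e1 - id] in characteristic 2, [u - id] is also a sum of three idempotents:
     [l = 1] reduces to [l = 0]. *)
  have l1' : lin (fun x => x - e1 x) by apply: lin_sub.
  apply: (trace_in_F2 c2 c2F l1' l2 l3 (shl 1) _ i2 i3 _ erefl tr).
    by move=> x; rewrite (linB l1) i1 subrr subr0.
  move=> x; rewrite scale0r add0r scale1r uE [RHS]addrC !(char2_opp c2).
  by rewrite !addrA.
move=> nc.
have fin_case l : in_F2 l -> finite_rank (fun x => u x - l *: x) ->
    idem3 id (fun x => u x - l *: x).
  move=> l01 fr; have [s hs] := fr.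
  have [n [b [c [cl _ sc]]]] := finite_coordinates s.
  pose phi (i : 'I_n) := pack_lin (lin_comp (cl i) (shl l)).
  have uE x : u x - l *: x = \sum_(i < n) phi i x *: b i.
    by rewrite {1}(sc (u x - l *: x)) //; apply/in_span_seqE.
  apply: (@idem3_finite_rank _ _ c2 c2F _ (shl l) n b (fun i => phi i)) => //.
    by move=> i; apply: lin_linear.
  apply: contrapT => nt; apply: nc; right; exists l; split.
    by case: l01 => ->; rewrite eqxx; [left|right].
  split=> //; exists (\sum_(i < n) phi i (b i)); split.
    by exists n, b, phi.
  by split; apply/eqP => e; apply: nt; [left|right].
have sh_case l : in_F2 l -> rank_lt_dim (fun x => u x - l *: x) ->
    idem3 id (fun x => u x - l *: x).
  move=> l01 dom; have [fr|nfr] := pselect (finite_rank (fun x => u x - l *: x)).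
    exact: fin_case.
  apply: (idem3_infinite_rank c2 (shl l) Vinf); right; split=> //.
  by rewrite (_ : (fun x => _) = (fun x => u x - l *: x)) //;
    apply/funext => x; rewrite scale0r subr0.
suff [e1 [e2 [e3 [uE eP]]]] : idem3 id u.
  have [l1 i1 _ _] := eP e1 (or_introl erefl).
  have [l2 i2 _ _] := eP e2 (or_intror (or_introl erefl)).
  have [l3 i3 _ _] := eP e3 (or_intror (or_intror erefl)).
  by exists (pack_lin l1), (pack_lin l2), (pack_lin l3).
have [d0|nd0] := pselect (rank_lt_dim (fun x => u x - 0 *: x)).
  have := sh_case 0 (or_introl erefl) d0.
  by rewrite (_ : (fun x => u x - 0 *: x) = u) //;
    apply/funext => x; rewrite scale0r subr0.
have [d1|nd1] := pselect (rank_lt_dim (fun x => u x - 1 *: x)).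
  have [e1 [e2 [e3 [uE eP]]]] := sh_case 1 (or_intror erefl) d1.
  have [l1 i1 _ _] := eP e1 (or_introl erefl).
  exists (fun x => x - e1 x), e2, e3; split=> [x|e].
    have := uE x; rewrite scale1r => /eqP; rewrite subr_eq => /eqP ->.
    by rewrite [LHS]addrC (char2_opp c2) !addrA.
  case=> [->|h]; last by apply: eP; right.
  split=> //; first by apply: lin_sub.
  by move=> x; rewrite (linB l1) i1 subrr subr0.
(* No dominant eigenvalue is left: 0 and 1 have been treated, and condition (i) excludes the
   others. *)
apply: (idem3_infinite_rank c2 ul Vinf); left => l dom.
apply: nc; left; exists l; split=> //.
by split; apply/eqP => e; rewrite e in dom.
Qed.
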